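(* Let $d\ge3$ and let $\zeta$ be uniformly distributed on $\partial B_1^d=\{x\in\mathbb{R}^d:\|x\|_1=1\}$. If $G:\mathbb{R}^d\to\mathbb{R}$ is continuously differentiable, then $$\mathrm{Var}(G(\zeta))\le\frac{4}{d(d-2)}\,\mathbb{E}\left[\|\nabla G(\zeta)\|_2^2\left(1+\sqrt d\,\|\zeta\|_2\right)^2\right].$$ Furthermore, if $G:\mathbb{R}^d\to\mathbb{R}$ is an $L$-Lipschitz function with respect to the $\ell_2$-norm, then $$\mathrm{Var}(G(\zeta))\le\frac{4L^2}{d(d-2)}\left(1+\sqrt{\frac{2d}{d+1}}\right)^2.$$
   Context: $\|\cdot\|_1,\|\cdot\|_2$ are the $\ell_1$- and $\ell_2$-norms on $\mathbb{R}^d$. ''Uniformly distributed on $\partial B_1^d$'' means distributed according to the normalized surface measure. *)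

(* Defs.v *)
(* R^d is 'rV[R]_d over an arbitrary R : realType. *)
From HB Require Import structures.
From mathcomp Require Import all_boot all_order all_algebra.
From mathcomp Require Import all_classical all_reals all_analysis.

Set Implicit Arguments.
Unset Strict Implicit.
Unset Printing Implicit Defensive.

Import Order.TTheory GRing.Theory Num.Theory.
Import numFieldNormedType.Exports.

Local Open Scope classical_set_scope.
Local Open Scope ring_scope.

(* The library's norm `|x| on 'rV[R]_d is the sup norm, whence the explicit
   l1 and l2 norms; the library's topology is the usual one of R^d. *)
Definition l1norm (R : realType) (d : nat) (x : 'rV[R]_d) : R :=
  \sum_(i < d) `|x 0 i|.

Definition l2norm (R : realType) (d : nat) (x : 'rV[R]_d) : R :=
  Num.sqrt (\sum_(i < d) x 0 i ^+ 2).

Definition l1sphere (R : realType) (d : nat) : set 'rV[R]_d :=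
  [set x | l1norm x = 1].

Definition grad (R : realType) (d : nat) (G : 'rV[R]_d -> R) (x : 'rV[R]_d) :
    'rV[R]_d :=
  \row_(i < d) 'D_(delta_mx 0 i) G x.

Definition continuously_differentiable (R : realType) (d : nat)
    (G : 'rV[R]_d -> R) : Prop :=
  (forall x, differentiable G x) /\ continuous (grad G).

Definition l2_lipschitz (R : realType) (d : nat) (L : R) (G : 'rV[R]_d -> R) :
    Prop :=
  forall x y, `|G x - G y| <= L * l2norm (x - y).

(* R^d with its Borel sigma-algebra. *)
Notation borel_rV R d := (g_sigma_algebraType (@open 'rV[R%type]_d)).

(* The Lebesgue integral over R^n of a nonnegative Borel function, written as
   an iterated one-dimensional Lebesgue integral (Tonelli), since the library
   has no n-dimensional Lebesgue measure. *)
Fixpoint lebesgue_integral_rV (R : realType) (n : nat) :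
    ('rV[R]_n -> \bar R) -> \bar R :=
  match n return ('rV[R]_n -> \bar R) -> \bar R with
  | 0 => fun f => f 0
  | m.+1 => fun f =>
      (\int[@lebesgue_measure R]_t
         lebesgue_integral_rV (fun u : 'rV[R]_m => f (row_mx t%:M u)))%E
  end.

(* Surface measure of the part in A of the graph {(g u, u) : u in D} of
   g : R^n -> R, with the classical surface element
   sqrt (1 + |grad g|_2 ^ 2) du. *)
Definition graph_surface (R : realType) (n : nat) (D : set 'rV[R]_n)
    (g : 'rV[R]_n -> R) (A : set 'rV[R]_n.+1) : \bar R :=
  lebesgue_integral_rV (fun u : 'rV[R]_n =>
    (\1_D u * \1_A (row_mx (g u)%:M u : 'rV[R]_n.+1) *
     Num.sqrt (1 + l2norm (grad g u) ^+ 2))%:E).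

(* Up to the equator x_0 = 0, which has dimension d - 2 and hence no surface,
   the unit l1 sphere is the disjoint union of the graphs
   x_0 = 1 - |u|_1 and x_0 = |u|_1 - 1 over the open unit l1 ball of R^(d-1).
   These functions fail to be differentiable only on the Lebesgue-null union
   of the coordinate hyperplanes. *)
Definition l1sphere_surface (R : realType) (d : nat) : set 'rV[R]_d -> \bar R :=
  match d return set 'rV[R]_d -> \bar R with
  | 0 => fun=> 0%E
  | n.+1 => fun A =>
      let D := [set u : 'rV[R]_n | l1norm u < 1] in
      (graph_surface D (fun u => (1 - l1norm u)%R) A +
       graph_surface D (fun u => (l1norm u - 1)%R) A)%E
  end.

Definition uniform_on_l1sphere (dO : measure_display) (Omega : measurableType dO)
    (R : realType) (P : probability Omega R) (d : nat)
    (zeta : {RV P >-> borel_rV R d}) : Prop :=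
  forall A : set (borel_rV R d), measurable A ->
    distribution P zeta A
    = (l1sphere_surface A / l1sphere_surface (@l1sphere R d))%E.

(* Main.v *)
Require Import Defs.
From HB Require Import structures.
From mathcomp Require Import all_boot all_order all_algebra.
From mathcomp Require Import all_classical all_reals all_analysis.
From mathcomp Require Import measurable_realfun.
From mathcomp Require Import ring lra.

Set Implicit Arguments.
Unset Strict Implicit.
Unset Printing Implicit Defensive.

Import Order.TTheory GRing.Theory Num.Theory.
Import numFieldNormedType.Exports.

Local Open Scope classical_set_scope.
Local Open Scope ring_scope.

(** Write N x = x / |x|_1 and let X have independent Laplace coordinates, of
density exp (- |t|) / 2. The density of X depends on |X|_1 alone, so that N X is
independent of |X|_1 and uniformly distributed on the unit sphere
([uniform_law], a consequence of the polar formula [l1_polar]). The variance of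
G zeta is therefore the variance of F X with F = G o N, a function of
independent variables.

Such a variance is at most the sum over i of the expected variances of F in its
i-th variable ([variance_tensorization]), and a Laplace variable satisfies the
Poincare inequality Var f <= 4 E (f' ^ 2) ([laplace_poincare]); hence Var (F X)
is at most four times the sum of the E (d_i F) ^ 2. With r = |x|_1, z = N x and
s the vector of signs of x,
  d_i F x = r ^-1 (d_i G z - <grad G z, z> s_i).
As <s, z> = 1, the bracket is the image of the gradient under an oblique
projection, of operator norm |s|_2 |z|_2 = sqrt d |z|_2
([oblique_projection]). The factor r ^-2 is independent of z and has mean
1 / ((d - 1) (d - 2)), so [variance_C1] gives, for G of class C^1,
  Var (G zeta) <= 4 / ((d - 1) (d - 2)) E (d |zeta|_2 ^ 2 |grad G zeta|_2 ^ 2).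
Now t = sqrt d |zeta|_2 is at most sqrt d <= d - 1, and t <= d - 1 implies
d t ^ 2 <= (d - 1) (1 + t) ^ 2 ([weight_comparison]): this is the first bound.

If moreover G is L-Lipschitz, then |grad G|_2 <= L, and
E |zeta|_2 ^ 2 = 2 / (d + 1) ([l1proj_second_moment]); the same comparison, at
t = sqrt (2 d / (d + 1)), yields the second bound for G of class C^1. A general
L-Lipschitz function is a uniform limit of L-Lipschitz functions of class C^1,
obtained by averaging along each coordinate direction in turn
([smooth_approximation]), and the variance is stable under uniform
perturbations ([variance_of_perturb]). *)

(** * Borel functions into and on the space of row vectors *)

Section borel_row_vectors.
Context {R : realType}.

Lemma rV_ballP n (x y : 'rV[R]_n) (e : R) : 0 < e ->
  ball x e y <-> forall i, `|x 0 i - y 0 i| < e.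
Proof.
move=> e0; split=> [[_ h] i|h]; first exact: (h 0 i).
by split=> // i j; rewrite ord1; exact: h.
Qed.

(** Every open set of R^n is the countable union of the rational boxes that it
contains, and the preimage of a box is a finite intersection of preimages under
the coordinates of [f]. *)
Lemma measurable_fun_rV d (T : measurableType d) n (f : T -> borel_rV R n) :
  (forall i, measurable_fun setT (fun x => (f x : 'rV[R]_n) 0 i)) ->
  measurable_fun setT f.
Proof.
move=> mf; apply: (@measurability _ _ T (borel_rV R n) setT f (@open 'rV[R]_n) erefl).
move=> _ [U oU <-]; rewrite setTI.
pose box (p : 'rV[rat]_n * nat) : set 'rV[R]_n :=
  [set y | forall i, `|y 0 i - ratr (p.1 0 i)| < p.2.+1%:R^-1].
have -> : f @^-1` U = \bigcup_(p in setT)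
    if pselect (box p `<=` U) then f @^-1` box p else set0.
  apply/seteqP; split=> [x /= Ux|x [p _] /=]; last first.
    by case: pselect => // pU /= xp; exact: pU.
  have /nbhs_ballP[e /= e0 eU] : nbhs (f x : 'rV[R]_n) U.
    by apply: open_nbhs_nbhs; split.
  have [k ke] : exists k : nat, k.+1%:R^-1 < e / 4.
    exists (Num.trunc (e / 4)^-1).
    rewrite invf_plt ?posrE ?divr_gt0//.
    by have /truncn_itv/andP[] : 0 <= (e / 4)^-1 by rewrite invr_ge0 divr_ge0// ltW.
  have [q hq] : exists q : 'rV[rat]_n, forall i,
      `|(f x : 'rV[R]_n) 0 i - ratr (q 0 i)| < k.+1%:R^-1.
    have /choice[q hq] : forall i : 'I_n, exists r : rat,
        `|(f x : 'rV[R]_n) 0 i - ratr r| < k.+1%:R^-1.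
      move=> i; have k0 : 0 < k.+1%:R^-1 :> R by rewrite invr_gt0.
      have := @dense_rat R (ball ((f x : 'rV[R]_n) 0 i) k.+1%:R^-1).
      case; first by exists ((f x : 'rV[R]_n) 0 i); exact: ballxx.
        exact: ball_open.
      by move=> z [+ [r _ rz]]; rewrite -rz => ?; exists r.
    by exists (\row_i q i) => i; rewrite mxE; exact: hq.
  exists (q, k) => //=; case: pselect => [_ //|] []; move=> y yq; apply: eU; apply/rV_ballP => //.
  move=> i; rewrite -(subrKA (ratr (q 0 i))) (le_lt_trans (ler_normD _ _))//.
  rewrite [`|_ - y 0 i|]distrC.
  rewrite (lt_trans (ltrD (lt_trans (hq i) ke) (lt_trans (yq i) ke)))//.
  by move: (e0 : 0 < e); clear; lra.
apply: countable_bigcupT_measurable => //.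
move=> p; case: (pselect (box p `<=` U)) => [pU|pU] /=; last exact: measurable0.
have -> : f @^-1` box p = \bigcap_(i in [set: 'I_n])
    (fun x => (f x : 'rV[R]_n) 0 i) @^-1` (ball (ratr (p.1 0 i) : R) p.2.+1%:R^-1).
  apply/seteqP; split=> x /= h i; first by move=> _ /=; rewrite /ball/= distrC; exact: h.
  by have := h i I; rewrite /ball /= distrC.
apply: fin_bigcap_measurable => // i _.
rewrite -[X in measurable X]setTI; apply: mf => //.
by apply: open_measurable; exact: ball_open.
Qed.

Lemma continuous_measurable_rV n (f : 'rV[R]_n -> R) :
  continuous f -> measurable_fun setT (f : borel_rV R n -> R).
Proof.
move=> cf; apply: (measurability _ (RGenOpens.measurableE R)).
move=> _ [_ [a [b ->]] <-]; rewrite setTI.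
by apply: sub_sigma_algebra; apply: open_comp => [x _|]; [exact: cf|exact: interval_open].
Qed.

Lemma measurable_coord n (i : 'I_n) :
  measurable_fun setT (fun x : borel_rV R n => (x : 'rV[R]_n) 0 i).
Proof. by apply: continuous_measurable_rV => x; exact: coord_continuous. Qed.

End borel_row_vectors.

(** * Powers of a measure on the line *)

Section product_measure_on_row_vectors.
Context {R : realType}.

Definition consv n (p : measurableTypeR R * borel_rV R n) : borel_rV R n.+1 :=
  row_mx (p.1 : R)%:M (p.2 : 'rV[R]_n).

Definition headv n (x : borel_rV R n.+1) : measurableTypeR R :=
  (x : 'rV[R]_n.+1) 0 ord0.

Definition tailv n (x : borel_rV R n.+1) : borel_rV R n :=
  \row_i (x : 'rV[R]_n.+1) 0 (lift ord0 i).

Lemma consv0 n (p : R * 'rV[R]_n) : (consv p : 'rV[R]_n.+1) 0 ord0 = p.1.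
Proof.
transitivity ((p.1%:M : 'M[R]_1) 0 0); last by rewrite mxE.
rewrite -(@row_mxEl R 1 1 n p.1%:M p.2 0 0).
by congr (row_mx _ _ _ _); exact: val_inj.
Qed.

Lemma consvS n (p : R * 'rV[R]_n) i :
  (consv p : 'rV[R]_n.+1) 0 (lift ord0 i) = p.2 0 i.
Proof.
rewrite -(@row_mxEr R 1 1 n p.1%:M p.2 0 i).
by congr (row_mx _ _ _ _); exact: val_inj.
Qed.

Lemma headv_consv n p : headv (@consv n p) = p.1.
Proof. exact: consv0. Qed.

Lemma tailv_consv n t (u : 'rV[R]_n) : tailv (consv (t, u)) = u.
Proof. by apply/rowP => i; rewrite mxE consvS. Qed.

Lemma rV0_eq (u v : 'rV[R]_0) : u = v.
Proof. by apply/rowP; case. Qed.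

Lemma measurable_consv n :
  measurable_fun setT (@consv n).
Proof.
apply: measurable_fun_rV => i; have [j ->|->] := unliftP ord0 i; last first.
  by under eq_fun do rewrite consv0; exact: (@measurable_fst _ _ (measurableTypeR R) (borel_rV R n)).
under eq_fun do rewrite consvS.
by apply: (measurableT_comp (measurable_coord j));
  exact: (@measurable_snd _ _ (measurableTypeR R) (borel_rV R n)).
Qed.

Lemma measurable_headv n : measurable_fun setT (@headv n).
Proof. exact: measurable_coord. Qed.

Lemma measurable_tailv n :
  measurable_fun setT (@tailv n).
Proof.
apply: measurable_fun_rV => i; under eq_fun do rewrite mxE.
exact: measurable_coord.
Qed.

Section cons_measure.
Variables (m : {sigma_finite_measure set (measurableTypeR R) -> \bar R}) (n : nat).
Variable mu : {sigma_finite_measure set (borel_rV R n) -> \bar R}.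
Local Open Scope ereal_scope.

Definition cons_measure (A : set (borel_rV R n.+1)) : \bar R :=
  pushforward (m \x mu) (@consv n) A.

Let P : {measure set (borel_rV R n.+1) -> \bar R} :=
  measure_function_pushforward__canonical__measure_function_Measure (m \x mu) (@measurable_consv n).

HB.instance Definition _ := isMeasure.Build _ _ _ cons_measure
  (measure0 P) (measure_ge0 P) (@measure_semi_sigma_additive _ _ _ P).

Let cons_measure_sigma_finite : sigma_finite setT cons_measure.
Proof.
have /sigma_finiteP[F [FT ndF Foo]] := sigma_finiteT m.
have /sigma_finiteP[G [GT ndG Goo]] := sigma_finiteT mu.
exists (fun k => (@headv n) @^-1` F k
                 `&` (@tailv n) @^-1` G k).
  apply/seteqP; split=> // x _.
  have [i _ Fi] : (\bigcup_i F i) (headv x) by rewrite -FT.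
  have [j _ Gj] : (\bigcup_i G i) (tailv x) by rewrite -GT.
  exists (maxn i j) => //; split => /=.
  - by move: Fi; exact/subsetPset/ndF/leq_maxl.
  - by move: Gj; exact/subsetPset/ndG/leq_maxr.
move=> k; have [mF Fk] := Foo k; have [mG Gk] := Goo k; split.
  apply: measurableI; rewrite -[X in measurable X]setTI.
    exact: measurable_headv.
  exact: measurable_tailv.
rewrite /cons_measure /pushforward (_ : _ @^-1` _ = F k `*` G k).
  by rewrite product_measure1E// lte_mul_pinfty// ge0_fin_numE.
by apply/seteqP; split=> -[t u]; rewrite /= headv_consv tailv_consv.
Qed.

HB.instance Definition _ := @Measure_isSigmaFinite.Build _ _ _
  cons_measure cons_measure_sigma_finite.

End cons_measure.


(** Built by adjoining a first coordinate, in step with the recursion of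
[lebesgue_integral_rV]. *)
Fixpoint mpow (m : {sigma_finite_measure set (measurableTypeR R) -> \bar R}) (n : nat) :
    {sigma_finite_measure set (borel_rV R n) -> \bar R} :=
  match n with
  | 0 => \d_(0 : borel_rV R 0)
  | k.+1 => cons_measure m (mpow m k)
  end.

Section Tonelli.
Variable m : {sigma_finite_measure set (measurableTypeR R) -> \bar R}.
Local Open Scope ereal_scope.

Lemma ge0_integral_mpow0 (f : borel_rV R 0 -> \bar R) : (forall x, 0 <= f x) ->
  \int[mpow m 0]_x f x = f (0%R : 'rV[R]_0).
Proof.
move=> f0 /=; rewrite integral_dirac//.
  by rewrite diracT mul1e.
move=> _ Y mY; rewrite setTI.
have [fY|fY] := pselect (Y (f (0%R : 'rV[R]_0))).
  rewrite (_ : _ @^-1` _ = setT)//; apply/seteqP; split=> // x _ /=.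
  by rewrite (rV0_eq x 0).
rewrite (_ : _ @^-1` _ = set0)//; apply/seteqP; split=> // x /=.
by rewrite (rV0_eq x 0).
Qed.

Lemma ge0_integral_mpowS n (f : borel_rV R n.+1 -> \bar R) :
  measurable_fun setT f -> (forall x, 0 <= f x) ->
  \int[mpow m n.+1]_x f x = \int[m]_t \int[mpow m n]_u f (consv (t, u)).
Proof.
move=> mf f0 /=.
transitivity (\int[(m \x mpow m n)]_p f (consv p)).
  rewrite -[RHS](ge0_integral_pushforward (@measurable_consv n) (m \x mpow m n) measurableT mf)//.
rewrite fubini_tonelli1//.
by apply: measurableT_comp => //; exact: measurable_consv.
Qed.

Lemma ge0_integral_mpowS_swap n (f : borel_rV R n.+1 -> \bar R) :
  measurable_fun setT f -> (forall x, 0 <= f x) ->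
  \int[mpow m n.+1]_x f x = \int[mpow m n]_u \int[m]_t f (consv (t, u)).
Proof.
move=> mf f0; rewrite ge0_integral_mpowS//.
apply: (@fubini_tonelli _ _ _ _ _ m (mpow m n) (f \o @consv n)) => [|x]; last exact: f0.
by apply: measurableT_comp => //; exact: measurable_consv.
Qed.

End Tonelli.

Lemma measurable_consvr n (t : R) :
  measurable_fun setT (fun u : borel_rV R n => consv (t, u)).
Proof.
by apply: measurableT_comp (@measurable_consv n) _; exact: measurable_pair1.
Qed.

Lemma measurable_consvl n (u : borel_rV R n) :
  measurable_fun setT (fun t : measurableTypeR R => consv (t, u)).
Proof.
by apply: measurableT_comp (@measurable_consv n) _; exact: measurable_pair2.
Qed.

(** Both sides are integrals for measures that agree on the intervals ]b, c],
hence on all Borel sets. *)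
Lemma ge0_integral_lebesgue_affine (f : measurableTypeR R -> \bar R) (a r : R) :
  0 < r -> measurable_fun setT f -> (forall x, 0 <= f x)%E ->
  (\int[lebesgue_measure]_t f t =
   r%:E * \int[lebesgue_measure]_t f (a + r * t)%R)%E.
Proof.
move=> r0 mf f0.
pose phi (t : measurableTypeR R) : measurableTypeR R := a + r * t.
have mphi : measurable_fun setT phi.
  by apply: measurable_funD => //; apply: measurable_funM.
pose P : {measure set (measurableTypeR R) -> \bar R} :=
  measure_function_pushforward__canonical__measure_function_Measure
    lebesgue_measure mphi.
pose Q : {measure set (measurableTypeR R) -> \bar R} := mscale (NngNum (ltW r0)) P.
transitivity (\int[Q]_t f t)%E.
  apply: eq_measure_integral => A mA _; apply/lebesgue_measure_unique => // {A mA}.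
  move=> _ [[b c]] /= bc <-; rewrite /Q /mscale /= /P /pushforward.
  rewrite (_ : phi @^-1` _ = `](b - a) / r, (c - a) / r]%classic).
    rewrite !lebesgue_measure_itv /= !lte_fin ltr_pM2r ?invr_gt0// ltrD2r.
    case: ifPn => _; last by rewrite mule0.
    by rewrite -EFinD -EFinM; congr EFin; field; rewrite gt_eqF.
  apply/seteqP; split => t /=; rewrite !in_itv /= /phi.
    by rewrite ltr_pdivrMr// ler_pdivlMr// ltrBlDl lerBrDl mulrC.
  by rewrite ltr_pdivrMr// ler_pdivlMr// ltrBlDl lerBrDl mulrC.
rewrite ge0_integral_mscale//=; congr (_ * _)%E.
by rewrite (ge0_integral_pushforward mphi lebesgue_measure measurableT mf).
Qed.

Lemma measurable_integral_consvr (m : {sigma_finite_measure set (measurableTypeR R) -> \bar R})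
    n (f : borel_rV R n.+1 -> \bar R) :
  measurable_fun setT f -> (forall x, 0 <= f x)%E ->
  measurable_fun setT (fun t : measurableTypeR R => \int[mpow m n]_u f (consv (t, u)))%E.
Proof.
move=> mf f0.
apply: (@measurable_fun_fubini_tonelli_F _ _ _ _ _ (mpow m n) (f \o @consv n)) => [|x]; last exact: f0.
by apply: measurableT_comp => //; exact: measurable_consv.
Qed.

Lemma measurable_integral_consvl (m : {sigma_finite_measure set (measurableTypeR R) -> \bar R})
    n (f : borel_rV R n.+1 -> \bar R) :
  measurable_fun setT f -> (forall x, 0 <= f x)%E ->
  measurable_fun setT (fun u : borel_rV R n => \int[m]_t f (consv (t, u)))%E.
Proof.
move=> mf f0.
apply: (@measurable_fun_fubini_tonelli_G _ _ _ _ _ m (f \o @consv n)) => [|x]; last exact: f0.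
by apply: measurableT_comp => //; exact: measurable_consv.
Qed.

Lemma measurable_scale_rV n (r : R) :
  measurable_fun setT (fun u : borel_rV R n => r *: (u : 'rV[R]_n) : borel_rV R n).
Proof.
apply: measurable_fun_rV => i; under eq_fun do rewrite mxE.
by apply: measurable_funM => //; exact: measurable_coord.
Qed.

Lemma scale_consv n r t (u : borel_rV R n) :
  r *: (consv (t, u) : 'rV[R]_n.+1) = consv (r * t, r *: (u : 'rV[R]_n)).
Proof.
apply/rowP => i; have [j ->|->] := unliftP ord0 i.
  by rewrite mxE !consvS mxE.
by rewrite mxE !consv0.
Qed.

Lemma ge0_integral_mpow_scale n (f : borel_rV R n -> \bar R) (r : R) :
  0 < r -> measurable_fun setT f -> (forall x, 0 <= f x)%E ->
  (\int[mpow lebesgue_measure n]_x f x =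
   (r ^+ n)%:E * \int[mpow lebesgue_measure n]_x f (r *: (x : 'rV[R]_n))%R)%E.
Proof.
move=> r0; elim: n f => [|n IH] f mf f0.
  by rewrite !ge0_integral_mpow0// expr0 mul1e (rV0_eq (r *: 0) 0).
have mfr : measurable_fun setT (fun x : borel_rV R n.+1 => f (r *: (x : 'rV[R]_n.+1))).
  exact: (measurableT_comp mf (@measurable_scale_rV n.+1 r)).
have mfI := measurable_integral_consvr lebesgue_measure mf f0.
rewrite (ge0_integral_mpowS _ mf f0) (ge0_integral_lebesgue_affine 0 r0 mfI); last first.
  by move=> t; exact: integral_ge0.
rewrite (ge0_integral_mpowS _ mfr (fun x => f0 _)) exprS EFinM -muleA; congr (_ * _)%E.
rewrite -ge0_integralZl//; last 3 first.
- exact: (@measurable_integral_consvr lebesgue_measure n _ mfr (fun x => f0 _)).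
- by move=> t _; exact: integral_ge0.
- by rewrite lee_fin exprn_ge0// ltW.
apply: eq_integral => t _; rewrite add0r IH//; last first.
  exact: (measurableT_comp mf (@measurable_consvr n (r * t))).
by congr (_ * _)%E; apply: eq_integral => u _; rewrite scale_consv.
Qed.

End product_measure_on_row_vectors.

(** * Polar coordinates for the l1 norm *)

Section polar.
Context {R : realType}.

(** Splitting off the sign of the variable turns the two sheets of the sphere, and
later the two halves of the Laplace density, into integrals over ]0, +oo[. *)
Lemma ge0_integral_lebesgue_split (f : measurableTypeR R -> \bar R) :
  measurable_fun setT f -> (forall x, 0 <= f x)%E ->
  (\int[lebesgue_measure]_t f t =
   \int[lebesgue_measure]_(t in `]0%R, +oo[) f t
   + \int[lebesgue_measure]_(t in `]0%R, +oo[) f (- t)%R)%E.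
Proof.
move=> mf f0.
have mfN : measurable_fun setT (f \o -%R : measurableTypeR R -> \bar R).
  by apply: measurableT_comp => //; exact: oppr_measurable.
rewrite -(setUv `]0%R, +oo[%classic) ge0_integral_setU//=; last first.
- by apply/disj_setPCl.
- by rewrite setUv.
- exact: measurableC.
congr (_ + _)%E.
rewrite setCitvr integral_itv_obnd_cbnd; last exact: measurable_funTS.
rewrite (ge0_integration_by_substitution0 mfN) /=; last by move=> r; exact: f0.
by apply: eq_integral => t _ /=; rewrite opprK.
Qed.

Lemma measurable_inv_fun d (T : measurableType d) (f : T -> R) :
  measurable_fun setT f -> measurable_fun setT (fun x => (f x)^-1).
Proof.
move=> mf.
have -> : (fun x => (f x)^-1) = (fun x => f x * ((f x) ^+ 2) `^ (-1)).
  apply/funext => x; rewrite powR_inv1 ?sqr_ge0//.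
  have [->|fx0] := eqVneq (f x) 0; first by rewrite mul0r invr0.
  by field.
apply: measurable_funM => //.
apply: (measurableT_comp (@measurable_powR R (-1))).
exact: measurable_funX.
Qed.

Lemma measurable_ltr_set d (T : measurableType d) (f g : T -> R) :
  measurable_fun setT f -> measurable_fun setT g ->
  measurable [set x | f x < g x].
Proof.
move=> mf mg; have /(_ measurableT [set true]) := measurable_fun_ltr mf mg.
by rewrite setTI; apply.
Qed.

Lemma l1norm_ge0 n (x : 'rV[R]_n) : 0 <= l1norm x.
Proof. by apply: sumr_ge0 => i _. Qed.

Lemma l1norm_consv n (p : measurableTypeR R * borel_rV R n) :
  l1norm (consv p : 'rV[R]_n.+1) = `|p.1 : R| + l1norm (p.2 : 'rV[R]_n).
Proof.
rewrite /l1norm big_ord_recl consv0; congr (_ + _).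
by apply: eq_bigr => i _; rewrite consvS.
Qed.

Lemma l1normZ n (r : R) (x : 'rV[R]_n) : l1norm (r *: x) = `|r| * l1norm x.
Proof.
by rewrite /l1norm mulr_sumr; apply: eq_bigr => i _; rewrite mxE normrM.
Qed.

Lemma measurable_l1norm n :
  measurable_fun setT (fun x : borel_rV R n => l1norm (x : 'rV[R]_n)).
Proof.
apply: measurable_sum => i.
by apply: measurableT_comp => //; exact: measurable_coord.
Qed.

Section half.
Variables (n : nat) (w : measurableTypeR R -> \bar R) (phi : borel_rV R n.+1 -> \bar R).
Hypotheses (mw : measurable_fun setT w) (w0 : forall r, (0 <= w r)%E).
Hypotheses (mphi : measurable_fun setT phi) (phi0 : forall x, (0 <= phi x)%E).
Variable s : R.

(* [K] is the integrand of [half_polar] in the variables (r, u) with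
   r = t + |u|_1, so that the half line t > 0 becomes r > |u|_1. *)
Let D : set (borel_rV R n) := [set u | l1norm (u : 'rV[R]_n) < 1].
Let K (x : borel_rV R n.+1) : \bar R :=
  ((\1_[set y : borel_rV R n.+1 | (l1norm (tailv y : 'rV[R]_n) < (headv y : R))%R] x)%:E *
  (w (headv x) * phi ((headv x : R)^-1 *:
      (consv (s * ((headv x : R) - l1norm (tailv x : 'rV[R]_n))
         , tailv x) : 'rV[R]_n.+1))%R))%E.

Let mK : measurable_fun setT K.
Proof.
have ml : measurable_fun setT (fun x : borel_rV R n.+1 => l1norm (tailv x : 'rV[R]_n)).
  by apply: (measurableT_comp (@measurable_l1norm n)); exact: measurable_tailv.
have mh := @measurable_headv R n.
apply: emeasurable_funM.
  apply/measurable_EFinP; apply: measurable_indic.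
  exact: measurable_ltr_set.
apply: emeasurable_funM; first exact: measurableT_comp.
apply: (measurableT_comp mphi); apply: measurable_fun_rV => i.
under eq_fun do rewrite mxE.
apply: measurable_funM.
  exact: measurable_inv_fun.
have [j ->|->] := unliftP ord0 i; [under eq_fun do rewrite consvS|under eq_fun do rewrite consv0 /=].
  exact: (measurableT_comp (measurable_coord j) (@measurable_tailv R n)).
by apply: measurable_funM => //; exact: measurable_funB.
Qed.

Let K0 x : (0 <= K x)%E.
Proof. by rewrite !mule_ge0// lee_fin. Qed.

(** For s = 1 or -1, polar coordinates on one of the two half spaces given by the
sign of the first coordinate: for fixed [u] substitute r = t + |u|_1, exchange the order of integration, and
rescale u by r, which produces the Jacobian r ^ n and makes the argument of
[phi] independent of r. *)
Lemma half_polar :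
  (\int[mpow lebesgue_measure n]_u \int[lebesgue_measure]_(t in `]0%R, +oo[)
     (w (t + l1norm (u : 'rV[R]_n))%R *
      phi ((t + l1norm (u : 'rV[R]_n))^-1 *: (consv (s * t, u) : 'rV[R]_n.+1))%R)
  = (\int[lebesgue_measure]_(r in `]0%R, +oo[) ((r ^+ n)%:E * w r)) *
    \int[mpow lebesgue_measure n]_u
      ((\1_D u)%:E * phi (consv (s * (1 - l1norm (u : 'rV[R]_n)), u)%R)))%E.
Proof.
have mphiD : measurable_fun setT (fun u : borel_rV R n =>
    ((\1_D u)%:E * phi (consv (s * (1 - l1norm (u : 'rV[R]_n)), u)%R)))%E.
  have ml := @measurable_l1norm n.
  apply: emeasurable_funM.
    apply/measurable_EFinP; apply: measurable_indic.
    exact: measurable_ltr_set.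
  apply: (measurableT_comp mphi); apply: (measurableT_comp (@measurable_consv R n)).
  apply: measurable_fun_pair => //.
  by apply: measurable_funM => //; exact: measurable_funB.
transitivity (\int[mpow lebesgue_measure n]_u \int[lebesgue_measure]_r K (consv (r, u)))%E.
  apply: eq_integral => u _; set c := l1norm (u : 'rV[R]_n).
  rewrite [RHS](@ge0_integral_lebesgue_affine _ _ c 1)//; last first.
    exact: (measurableT_comp mK (@measurable_consvl _ n u)).
  rewrite mul1e integral_mkcond; apply: eq_integral => t _.
  rewrite patchE /K headv_consv tailv_consv /= mul1r -/c [in RHS](addrC c).
  rewrite indicE /= addrK.
  have -> : (t \in `]0%R, +oo[%classic) = ((consv ((t + c)%R, u)) \in
      [set y : borel_rV R n.+1 | (l1norm (tailv y : 'rV[R]_n) < (headv y : R))%R]).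
    apply/idP/idP; rewrite !inE /= headv_consv tailv_consv /= -/c in_itv /= andbT;
    by rewrite ltrDr.
  by case: ifP; rewrite ?mul1e ?mul0e.
rewrite -(ge0_integral_mpowS_swap lebesgue_measure mK)// ge0_integral_mpowS//.
rewrite -ge0_integralZr//; last 3 first.
- apply: emeasurable_funM; last exact: measurable_funTS.
  by apply/measurable_EFinP; exact: measurable_funX.
- move=> r; rewrite /= in_itv /= andbT => r0.
  by rewrite mule_ge0// lee_fin exprn_ge0// ltW.
- by apply: integral_ge0 => u _; rewrite mule_ge0// lee_fin.
rewrite [RHS]integral_mkcond; apply: eq_integral => r _; rewrite patchE.
have [r0|r0] := ltP 0 r; last first.
  rewrite memNset /= ?in_itv /= ?andbT; last by apply/negP; rewrite -leNgt.
  rewrite integral0_eq// => u _.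
  rewrite /K headv_consv tailv_consv indicE memNset ?mul0e//=.
  rewrite headv_consv tailv_consv /=; apply/negP; rewrite -leNgt.
  by rewrite (le_trans r0)// l1norm_ge0.
rewrite mem_set /= ?in_itv /= ?andbT//.
rewrite (@ge0_integral_mpow_scale _ _ _ r)//; last first.
  exact: (measurableT_comp mK (@measurable_consvr _ n r)).
rewrite -muleA; congr (_ * _)%E.
rewrite -ge0_integralZl//; last first.
  by move=> u _; rewrite mule_ge0// lee_fin.
apply: eq_integral => u _.
rewrite /K headv_consv tailv_consv /= l1normZ gtr0_norm//.
rewrite [in LHS]muleCA; congr (_ * (_ * _))%E.
  rewrite !indicE /=; congr ((nat_of_bool _)%:R%:E).
  apply/idP/idP; rewrite !inE /= headv_consv tailv_consv /= l1normZ gtr0_norm//.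
    by rewrite gtr_pMr.
  by rewrite gtr_pMr.
congr (phi _); rewrite scale_consv scalerA mulVf ?gt_eqF// scale1r.
by congr (consv (_, _)); field; rewrite gt_eqF.
Qed.
End half.

Lemma measurable_integral_consvl_gt0 n (H : borel_rV R n.+1 -> \bar R) :
  measurable_fun setT H -> (forall x, 0 <= H x)%E ->
  measurable_fun setT (fun u : borel_rV R n =>
    \int[lebesgue_measure]_(t in `]0%R, +oo[) H (consv (t, u)))%E.
Proof.
move=> mH H0.
pose H' x := ((\1_[set y : borel_rV R n.+1 | (0 < (headv y : R))%R] x)%:E * H x)%E.
have mH' : measurable_fun setT H'.
  apply: emeasurable_funM => //; apply/measurable_EFinP; apply: measurable_indic.
  by apply: measurable_ltr_set => //; exact: measurable_headv.
have H'0 x : (0 <= H' x)%E by rewrite mule_ge0// lee_fin.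
apply: eq_measurable_fun (measurable_integral_consvl lebesgue_measure mH' H'0).
move=> u _; rewrite [RHS]integral_mkcond; apply: eq_integral => t _.
rewrite patchE /H' indicE; have [t0|t0] := ltP 0 t.
  by rewrite !mem_set ?mul1e//= ?headv_consv ?in_itv /= ?andbT.
rewrite !memNset ?mul0e//= ?headv_consv ?in_itv /= ?andbT//;
  by apply/negP; rewrite -leNgt.
Qed.

(** The surface integral over the l1 sphere, divided by the surface element
sqrt n.+1, which is the same constant on both sheets. *)
Definition surface_integral n (phi : borel_rV R n.+1 -> \bar R) : \bar R :=
  let D := [set u : borel_rV R n | l1norm (u : 'rV[R]_n) < 1] in
  (\int[mpow lebesgue_measure n]_u
     ((\1_D u)%:E * phi (consv (1 - l1norm (u : 'rV[R]_n), u)%R)) +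
   \int[mpow lebesgue_measure n]_u
     ((\1_D u)%:E * phi (consv (l1norm (u : 'rV[R]_n) - 1, u)%R)))%E.

(** The value at the origin, where the inverse is 0, is the origin; it is never
seen by a measure with density. *)
Definition l1proj n (x : borel_rV R n) : borel_rV R n :=
  (l1norm (x : 'rV[R]_n))^-1 *: (x : 'rV[R]_n).

Lemma measurable_l1proj n : measurable_fun setT (@l1proj n).
Proof.
apply: measurable_fun_rV => i; under eq_fun do rewrite mxE.
apply: measurable_funM; last exact: measurable_coord.
by apply: measurable_inv_fun; exact: measurable_l1norm.
Qed.

(** The two half spaces where the first coordinate is positive or negative are
carried onto the two sheets of the sphere. *)
Theorem l1_polar n (w : measurableTypeR R -> \bar R) (phi : borel_rV R n.+1 -> \bar R) :
  measurable_fun setT w -> (forall r, 0 <= w r)%E ->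
  measurable_fun setT phi -> (forall x, 0 <= phi x)%E ->
  (\int[mpow lebesgue_measure n.+1]_x
      (w (l1norm (x : 'rV[R]_n.+1)) * phi (l1proj x)) =
   (\int[lebesgue_measure]_(r in `]0%R, +oo[) ((r ^+ n)%:E * w r)) *
   surface_integral phi)%E.
Proof.
move=> mw w0 mphi phi0.
pose H (x : borel_rV R n.+1) := (w (l1norm (x : 'rV[R]_n.+1)) * phi (l1proj x))%E.
have mH : measurable_fun setT H.
  apply: emeasurable_funM.
    exact: (measurableT_comp mw (@measurable_l1norm n.+1)).
  exact: (measurableT_comp mphi (@measurable_l1proj n.+1)).
have H0 x : (0 <= H x)%E by rewrite mule_ge0.
pose HN (x : borel_rV R n.+1) := H (consv (- (headv x : R), tailv x)).
have mHN : measurable_fun setT HN.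
  apply: (measurableT_comp mH); apply: (measurableT_comp (@measurable_consv R n)).
  apply: measurable_fun_pair; last exact: measurable_tailv.
  by apply: measurable_funN; exact: measurable_headv.
rewrite [LHS](ge0_integral_mpowS_swap lebesgue_measure mH H0).
transitivity (\int[mpow lebesgue_measure n]_u
   (\int[lebesgue_measure]_(t in `]0%R, +oo[) H (consv (t, u)) +
    \int[lebesgue_measure]_(t in `]0%R, +oo[) HN (consv (t, u))))%E.
  apply: eq_integral => u _.
  have mHu := measurableT_comp mH (@measurable_consvl _ n u).
  rewrite (ge0_integral_lebesgue_split mHu (fun t => H0 _)).
  congr (_ + _)%E; apply: eq_integral => t _.
  by rewrite /HN headv_consv tailv_consv.
rewrite ge0_integralD//; last 4 first.
- by move=> u _; exact: integral_ge0.
- exact: measurable_integral_consvl_gt0.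
- by move=> u _; apply: integral_ge0 => t _; exact: H0.
- by apply: measurable_integral_consvl_gt0 => // x; exact: H0.
rewrite ge0_muleDr; last 2 first.
- by apply: integral_ge0 => u _; rewrite mule_ge0// lee_fin.
- by apply: integral_ge0 => u _; rewrite mule_ge0// lee_fin.
congr (_ + _)%E.
  under [X in _ = (_ * X)%E]eq_integral do rewrite -[(1 - _)%R]mul1r.
  rewrite -(half_polar mw w0 mphi phi0).
  apply: eq_integral => u _; apply: eq_integral => t.
  rewrite inE /= in_itv /= andbT => t0.
  by rewrite /H /l1proj l1norm_consv /= gtr0_norm// mul1r.
under [X in _ = (_ * X)%E]eq_integral do rewrite -[(_ - 1)%R]opprB -mulN1r.
rewrite -(half_polar mw w0 mphi phi0).
apply: eq_integral => u _; apply: eq_integral => t.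
rewrite inE /= in_itv /= andbT => t0.
rewrite /HN headv_consv tailv_consv /= /H /l1proj l1norm_consv /= normrN.
by rewrite gtr0_norm// mulN1r.
Qed.

End polar.

(** * Integration against a density *)

Section density.
Local Open Scope ereal_scope.
Context d (T : measurableType d) {R : realType}.
Variables (mu nu : {measure set T -> \bar R}) (p : T -> \bar R).
Hypotheses (mp : measurable_fun setT p) (p0 : forall x, 0 <= p x).
Hypothesis pfin : forall x, p x \is a fin_num.
Hypothesis nuE : forall A, measurable A -> nu A = \int[mu]_(x in A) p x.

Import HBNNSimple.

(** For simple functions this is the definition of the density; both sides pass
to increasing limits. *)
Lemma ge0_integral_density (f : T -> \bar R) : measurable_fun setT f ->
  (forall x, 0 <= f x) -> \int[nu]_x f x = \int[mu]_x (f x * p x).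
Proof.
move=> mf f0; pose h := nnsfun_approx measurableT mf.
have fE x : f x = limn (fun n => (h n x)%:E).
  by apply/esym/cvg_lim => //; exact: cvg_nnsfun_approx.
have -> : \int[nu]_x f x = limn (fun n => \int[nu]_x (h n x)%:E).
  under eq_integral do rewrite fE.
  apply: monotone_convergence => //.
  - by move=> n; apply/measurable_EFinP.
  - by move=> n x _; rewrite lee_fin.
  - by move=> x _ a b ab; rewrite lee_fin; exact/lefP/nd_nnsfun_approx.
have -> : \int[mu]_x (f x * p x) = limn (fun n => \int[mu]_x ((h n x)%:E * p x)).
  have fpE x : f x * p x = limn (fun n => (h n x)%:E * p x).
    by apply/esym/cvg_lim => //; apply: cvgeZr => //; exact: cvg_nnsfun_approx.
  under eq_integral do rewrite fpE.
  apply: monotone_convergence => //.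
  - by move=> n; apply: emeasurable_funM => //; exact/measurable_EFinP.
  - by move=> n x _; rewrite mule_ge0// lee_fin.
  - move=> x _ a b ab; rewrite lee_wpmul2r// lee_fin.
    exact/lefP/nd_nnsfun_approx.
suff E n : \int[nu]_x (h n x)%:E = \int[mu]_x ((h n x)%:E * p x).
  by under eq_fun do rewrite E.
under eq_integral do rewrite fimfunE -fsumEFin//.
have mi r : measurable_fun setT (fun x => (r * \1_(h n @^-1` [set r]) x)%:E).
  by apply/measurable_EFinP; exact: measurable_funM.
rewrite ge0_integral_fsum//; last by move=> y x _; exact: nnfun_muleindic_ge0.
under [RHS]eq_integral.
  move=> x _; rewrite fimfunE -fsumEFin// ge0_mule_fsuml; last first.
    by move=> y; exact: nnfun_muleindic_ge0.
  over.
rewrite [RHS]ge0_integral_fsum//; last 2 first.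
- by move=> y; exact: emeasurable_funM.
- by move=> y x _; rewrite mule_ge0// nnfun_muleindic_ge0.
apply: eq_fsbigr => r _.
under eq_integral do rewrite EFinM.
rewrite integralZl_indic_nnsfun//.
rewrite integral_indic// setIT.
have [r0|r0] := leP 0%R r; last first.
  rewrite preimage_nnfun0// measure0 mule0 integral0_eq// => x _.
  by rewrite indic0 mulr0 mul0e.
under eq_integral do rewrite EFinM -muleA.
rewrite ge0_integralZl_EFin//; last 2 first.
- by move=> x _; rewrite mule_ge0// lee_fin.
- by apply: emeasurable_funM => //; exact/measurable_EFinP.
congr (_ * _); rewrite nuE// [LHS]integral_mkcond.
apply: eq_integral => x _; rewrite patchE indicE.
by case: ifP => _; rewrite ?mul1e ?mul0e.
Qed.

End density.

(** * The integrals of r ^ k exp (- r) *)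

Section gamma.
Context {R : realType}.

Lemma cvg_exprn_expRN k : (x : R) ^+ k * expR (- x) @[x --> +oo] --> (0 : R).
Proof.
apply/cvgrPdist_le => /= e e0; near=> x.
have x0 : 0 < x by near: x; exact: nbhs_pinfty_gt.
rewrite sub0r normrN ger0_norm; last by rewrite mulr_ge0 ?expR_ge0// exprn_ge0// ltW.
have f0 : 0 < k.+1`!%:R :> R by rewrite ltr0n fact_gt0.
apply: (@le_trans _ _ (k.+1`!%:R / x)).
  (* x ^ k.+1 / k.+1! is dominated by exp x *)
  rewrite ler_pdivlMr// mulrAC -exprSr expRN ler_pdivrMr ?expR_gt0//.
  rewrite mulrC -ler_pdivrMr//.
  by rewrite (le_trans _ (expR_ge1Dxn k (ltW x0)))// lerDr.
rewrite ler_pdivrMr// mulrC -(ler_pdivrMr _ _ e0).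
by near: x; apply: nbhs_pinfty_ge; exact: num_real.
Unshelve. all: by end_near. Qed.

(** The primitive of x ^ k exp (- x) that vanishes at +oo, by iterated integration
by parts. *)
Fixpoint gamma_primitive k (x : R) : R :=
  match k with
  | 0 => - expR (- x)
  | j.+1 => - (x ^+ j.+1 * expR (- x)) + j.+1%:R * gamma_primitive j x
  end.

Lemma is_derive_gamma_primitive k (x : R) :
  is_derive x 1 (gamma_primitive k) (x ^+ k * expR (- x)).
Proof.
elim: k => [|k IH] /=.
  by apply: is_derive_eq; rewrite mulrN1 opprK mul1r.
have d1 : is_derive x 1 (fun y : R => y ^+ k.+1 * expR (- y))
    (k.+1%:R * (x ^+ k * expR (- x)) - x ^+ k.+1 * expR (- x)).
  have dX : is_derive x 1 (fun y : R => y ^+ k.+1) (k.+1%:R * x ^+ k).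
    have -> : (fun y : R => y ^+ k.+1) = id ^+ k.+1.
      by apply/funext => y; rewrite exprfctE.
    by apply: is_derive_eq; rewrite /GRing.scale /= mulr1.
  have dE : is_derive x 1 (fun y : R => expR (- y)) (- expR (- x)).
    by apply: is_derive_eq; rewrite mulrN1.
  apply: (is_derive_eq (is_deriveM dX dE)).
  by rewrite /= /GRing.scale /=; ring.
apply: (is_derive_eq (is_deriveD (is_deriveN d1) (is_deriveZ k.+1%:R IH))).
by rewrite opprB /GRing.scale /= subrK.
Qed.

Lemma gamma_primitive0 k : gamma_primitive k 0 = - k`!%:R.
Proof.
elim: k => [|k IH] /=; first by rewrite oppr0 expR0 fact0.
by rewrite expr0n mul0r oppr0 add0r IH factS natrM mulrN.
Qed.

Lemma cvg_gamma_primitive k : gamma_primitive k x @[x --> +oo] --> (0 : R).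
Proof.
elim: k => [|k IH] /=.
  by rewrite -oppr0; apply: cvgN; exact: cvgr_expR.
rewrite -[X in _ --> X]addr0 -{1}oppr0.
apply: cvgD; first by apply: cvgN; exact: cvg_exprn_expRN.
by have H := @cvgMl_tmp _ _ _ _ _ (k.+1%:R : R) _ IH; rewrite mulr0 in H; exact: H.
Qed.

Lemma gamma_integral k :
  (\int[lebesgue_measure]_(r in `]0%R, +oo[) (r ^+ k * expR (- r) : R)%:E)%E = (k`!%:R : R)%:E.
Proof.
have cont : continuous (fun r : R => r ^+ k * expR (- r)).
  move=> x; apply: cvgM.
    exact: exprn_continuous.
  by apply: continuous_comp; [by apply: cvgN; exact: cvg_id|exact: continuous_expR].
rewrite integral_itv_obnd_cbnd; last first.
  by apply/measurable_EFinP; apply: measurable_funTS; exact: continuous_measurable_fun.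
rewrite (@ge0_continuous_FTC2y _ _ (gamma_primitive k) _ 0)//.
- by rewrite gamma_primitive0 -EFinN opprK add0e.
- by move=> x x0; rewrite mulr_ge0 ?expR_ge0 ?exprn_ge0.
- exact: continuous_subspaceT.
- exact: cvg_gamma_primitive.
- by move=> x _; have [] := is_derive_gamma_primitive k x.
- apply: cvg_at_right_filter; apply/differentiable_continuous/derivable1_diffP.
  by have [] := is_derive_gamma_primitive k 0.
- move=> x _; rewrite derive1E.
  by have /@derive_val -> := is_derive_gamma_primitive k x.
Qed.
End gamma.

(** * The Laplace distribution and its powers *)

Section laplace.
Context {R : realType}.

Definition laplace_pdf (t : R) : R := expR (- `|t|) / 2.

Lemma laplace_pdf_ge0 t : 0 <= laplace_pdf t.
Proof. by rewrite divr_ge0// expR_ge0. Qed.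

Lemma measurable_laplace_pdf : measurable_fun [set: measurableTypeR R] laplace_pdf.
Proof.
apply: measurable_funM => //; apply: measurableT_comp; first exact: measurable_expR.
by apply: measurable_funN; exact: normr_measurable.
Qed.

Definition laplace_prob (A : set (measurableTypeR R)) : \bar R :=
  (\int[lebesgue_measure]_(t in A) (laplace_pdf t)%:E)%E.

Let laplace_prob0 : laplace_prob set0 = 0%E.
Proof. exact: integral_set0. Qed.

Let laplace_prob_ge0 A : (0 <= laplace_prob A)%E.
Proof. by apply: integral_ge0 => t _; rewrite lee_fin laplace_pdf_ge0. Qed.

Let laplace_prob_sigma_additive : semi_sigma_additive laplace_prob.
Proof.
move=> /= F mF tF mUF; rewrite /laplace_prob; apply: cvg_toP.
  apply: ereal_nondecreasing_is_cvgn => m n mn.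
  apply: lee_sum_nneg_natr => // k _ _; apply: integral_ge0 => /= x Fkx.
  by rewrite lee_fin laplace_pdf_ge0.
rewrite ge0_integral_bigcup//=.
- by apply/measurable_EFinP; apply: measurable_funTS; exact: measurable_laplace_pdf.
- by move=> x _; rewrite lee_fin laplace_pdf_ge0.
Qed.

HB.instance Definition _ := isMeasure.Build _ _ _ laplace_prob
  laplace_prob0 laplace_prob_ge0 laplace_prob_sigma_additive.

Let laplace_prob_setT : laplace_prob setT = 1%E.
Proof.
rewrite /laplace_prob ge0_integral_lebesgue_split; last 2 first.
- by apply/measurable_EFinP; exact: measurable_laplace_pdf.
- by move=> t; rewrite lee_fin laplace_pdf_ge0.
have E : (\int[lebesgue_measure]_(t in `]0%R, +oo[) (laplace_pdf t)%:E = (2^-1 : R)%:E)%E.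
  transitivity (\int[lebesgue_measure]_(t in `]0%R, +oo[)
      ((2^-1 : R)%:E * (t ^+ 0 * expR (- t))%:E))%E.
    apply: eq_integral => t; rewrite inE/= in_itv /= andbT => t0.
    by rewrite /laplace_pdf gtr0_norm// -EFinM expr0 mul1r mulrC.
  rewrite ge0_integralZl//; last 2 first.
  - apply/measurable_EFinP; apply: measurable_funTS; apply: measurable_funM => //.
    by apply: measurableT_comp => //; exact: measurable_expR.
  - by move=> t _; rewrite lee_fin expr0 mul1r expR_ge0.
  by rewrite gamma_integral fact0 -EFinM mulr1.
have -> : (\int[lebesgue_measure]_(t in `]0%R, +oo[) (laplace_pdf (- t))%:E = (2^-1 : R)%:E)%E.
  by rewrite -E; apply: eq_integral => t _; rewrite /laplace_pdf normrN.
by rewrite E -EFinD; congr EFin; lra.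
Qed.

HB.instance Definition _ :=
  @Measure_isProbability.Build _ _ R laplace_prob laplace_prob_setT.

Lemma ge0_integral_laplace (f : measurableTypeR R -> \bar R) :
  measurable_fun setT f -> (forall x, 0 <= f x)%E ->
  (\int[laplace_prob]_t f t = \int[lebesgue_measure]_t (f t * (laplace_pdf t)%:E))%E.
Proof.
move=> mf f0; apply: ge0_integral_density => //.
- by apply/measurable_EFinP; exact: measurable_laplace_pdf.
- by move=> t; rewrite lee_fin laplace_pdf_ge0.
Qed.

Definition laplace_rV_pdf n (x : 'rV[R]_n) : R := 2^-1 ^+ n * expR (- l1norm x).

Lemma laplace_rV_pdf_ge0 n (x : 'rV[R]_n) : 0 <= laplace_rV_pdf x.
Proof. by rewrite mulr_ge0 ?expR_ge0// exprn_ge0. Qed.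

Lemma measurable_laplace_rV_pdf n :
  measurable_fun setT (fun x : borel_rV R n => laplace_rV_pdf (x : 'rV[R]_n)).
Proof.
apply: measurable_funM => //; apply: measurableT_comp; first exact: measurable_expR.
by apply: measurable_funN; exact: measurable_l1norm.
Qed.

Lemma laplace_rV_pdf_consv n (t : R) (u : borel_rV R n) :
  laplace_rV_pdf (consv (t, u) : 'rV[R]_n.+1) = laplace_pdf t * laplace_rV_pdf (u : 'rV[R]_n).
Proof.
by rewrite /laplace_rV_pdf l1norm_consv /= opprD expRD exprS /laplace_pdf; field.
Qed.

Lemma ge0_integral_laplace_rV n (f : borel_rV R n -> \bar R) :
  measurable_fun setT f -> (forall x, 0 <= f x)%E ->
  (\int[mpow laplace_prob n]_x f x =
   \int[mpow lebesgue_measure n]_x (f x * (laplace_rV_pdf (x : 'rV[R]_n))%:E))%E.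
Proof.
elim: n f => [|n IH] f mf f0.
  rewrite !ge0_integral_mpow0//.
    by rewrite /laplace_rV_pdf expr0 mul1r /l1norm big_ord0 oppr0 expR0 mule1.
  by move=> x; rewrite mule_ge0// lee_fin laplace_rV_pdf_ge0.
rewrite !ge0_integral_mpowS//; last 2 first.
- apply: emeasurable_funM => //; apply/measurable_EFinP.
  exact: measurable_laplace_rV_pdf.
- by move=> x; rewrite mule_ge0// lee_fin laplace_rV_pdf_ge0.
rewrite ge0_integral_laplace; last 2 first.
- exact: measurable_integral_consvr.
- by move=> t; exact: integral_ge0.
apply: eq_integral => t _.
have mft : measurable_fun setT (fun u => f (consv (t, u))).
  exact: (measurableT_comp mf (@measurable_consvr _ n t)).
rewrite IH//.
have mp := @measurable_laplace_rV_pdf n.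
rewrite muleC -ge0_integralZl//; last 3 first.
- by apply: emeasurable_funM => //; apply/measurable_EFinP.
- by move=> x _; rewrite mule_ge0// lee_fin laplace_rV_pdf_ge0.
- by rewrite lee_fin laplace_pdf_ge0.
apply: eq_integral => u _.
by rewrite laplace_rV_pdf_consv EFinM muleCA.
Qed.

(** The density of the product law is a function of the l1 norm, so the radial and
the angular parts separate. *)
Lemma laplace_polar n (w : measurableTypeR R -> R) (phi : borel_rV R n.+1 -> \bar R) :
  measurable_fun setT w -> (forall r, 0 <= w r) ->
  measurable_fun setT phi -> (forall x, 0 <= phi x)%E ->
  (\int[mpow laplace_prob n.+1]_x
      ((w (l1norm (x : 'rV[R]_n.+1)))%:E * phi (l1proj x)) =
   (2^-1 ^+ n.+1)%:E * (\int[lebesgue_measure]_(r in `]0%R, +oo[)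
      (r ^+ n * w r * expR (- r))%:E) * surface_integral phi)%E.
Proof.
move=> mw w0 mphi phi0.
have mN := @measurable_l1norm R n.+1.
rewrite ge0_integral_laplace_rV; last 2 first.
- apply: emeasurable_funM; first by apply/measurable_EFinP; exact: measurableT_comp mN.
  exact: (measurableT_comp mphi (@measurable_l1proj _ n.+1)).
- by move=> x; rewrite mule_ge0// lee_fin.
pose w' (r : measurableTypeR R) : \bar R := (2^-1 ^+ n.+1 * w r * expR (- r))%:E.
have mw' : measurable_fun setT w'.
  rewrite /w'; apply/measurable_EFinP; apply: measurable_funM; first exact: measurable_funM.
  by apply: measurableT_comp; first exact: measurable_expR.
have w'0 r : (0 <= w' r)%E.
  by rewrite lee_fin mulr_ge0 ?expR_ge0// mulr_ge0// exprn_ge0.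
transitivity (\int[mpow lebesgue_measure n.+1]_x
      (w' (l1norm (x : 'rV[R]_n.+1)) * phi (l1proj x)))%E.
  apply: eq_integral => x _.
  by rewrite muleAC -EFinM /laplace_rV_pdf /w'; congr (_%:E * _)%E; ring.
rewrite l1_polar//; congr (_ * _)%E.
rewrite -ge0_integralZl//; last 2 first.
- apply/measurable_EFinP; apply: measurable_funTS.
  apply: measurable_funM; last by apply: measurableT_comp; first exact: measurable_expR.
  by apply: measurable_funM => //; exact: measurable_funX.
- move=> r /=; rewrite in_itv /= andbT => r0.
  by rewrite lee_fin mulr_ge0 ?expR_ge0// mulr_ge0// exprn_ge0// ltW.
by apply: eq_integral => r _; rewrite /w' -!EFinM; congr EFin; ring.
Qed.

End laplace.

(** * Surface measure of the l1 sphere *)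

Section surface.
Context {R : realType}.

(** The surface element of the sheets is controlled only off the coordinate
hyperplanes, so [f] is not known to be Borel: it is compared with a Borel
function [g] inside the iterated integral, one null set of the line at a time. *)
Lemma lebesgue_integral_rV_off_hyperplanes n (f : 'rV[R]_n -> \bar R)
    (g : borel_rV R n -> \bar R) :
  measurable_fun setT g -> (forall x, 0 <= g x)%E -> (forall x, 0 <= f x)%E ->
  (forall x : 'rV[R]_n, (forall i, x 0 i != 0) -> f x = g x) ->
  (lebesgue_integral_rV f = \int[mpow lebesgue_measure n]_x g x)%E.
Proof.
elim: n f g => [|n IH] f g mg g0 f0 fg.
  by rewrite ge0_integral_mpow0//= fg//; case.
rewrite ge0_integral_mpowS//=.
pose F (t : measurableTypeR R) : \bar R :=
  lebesgue_integral_rV (fun u => f (consv (t, u) : 'rV[R]_n.+1)).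
pose G (t : measurableTypeR R) := (\int[mpow lebesgue_measure n]_u g (consv (t, u)))%E.
have FG t : t != 0 -> F t = G t.
  move=> t0; apply: IH => //.
    exact: (measurableT_comp mg (@measurable_consvr _ n t)).
  move=> u u0; apply: fg => i; have [j ->|->] := unliftP ord0 i.
    by rewrite consvS.
  by rewrite consv0.
have mG : measurable_fun setT G by exact: measurable_integral_consvr.
have FE : F = fun t => if t == 0 then F 0 else G t.
  by apply/funext => t; case: eqVneq => [->//|/FG].
have mF : measurable_fun setT F.
  rewrite FE; apply: measurable_fun_ifT => //.
  exact: measurable_fun_eqr.
change (\int[lebesgue_measure]_t F t = \int[lebesgue_measure]_t G t)%E.
apply: ae_eq_integral => //.
exists [set 0]; split => //; first exact: lebesgue_measure_set1.
move=> t /= /not_implyP[_]; apply: contra_notP => /eqP t0; exact: FG.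
Qed.

(** Near a point whose i-th coordinate is not 0 the norm is affine in direction i. *)
Lemma derive_l1norm n (a s : R) (u : 'rV[R]_n) i : u 0 i != 0 ->
  'D_(delta_mx 0 i) (fun v => a + s * l1norm v) u = s * Num.sg (u 0 i).
Proof.
move=> ui0; apply: cvg_lim => //.
apply: cvg_near_cst; near=> h.
have h0 : h != 0 by near: h; exact: nbhs_dnbhs_neq.
have hu : `|h| < `|u 0 i|.
  by near: h; apply: dnbhs0_lt; rewrite normr_gt0.
have E : l1norm (h *: delta_mx 0 i + u) = l1norm u + Num.sg (u 0 i) * h.
  rewrite /l1norm (bigD1 i)//= [in RHS](bigD1 i)//= !mxE !eqxx mulr1 addrAC.
  congr (_ + _); last first.
    by apply: eq_bigr => j ji; rewrite !mxE (negbTE ji) andbF mulr0 add0r.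
  case: sgrP => [/eqP|ui|ui]; first by rewrite (negbTE ui0).
    rewrite mul1r addrC gtr0_norm//.
    by move: hu; rewrite (gtr0_norm ui) ltr_norml => /andP[+ _]; lra.
  rewrite mulN1r -opprD addrC ltr0_norm//.
  by move: hu; rewrite (ltr0_norm ui) ltr_norml => /andP[_]; lra.
rewrite /= E /GRing.scale /=; field.
exact: h0.
Unshelve. all: by end_near. Qed.

(** Off the coordinate hyperplanes the gradient of a + s |u|_1 has all its entries
equal to 1 or -1, so the surface element is the constant sqrt (1 + n). *)
Lemma graph_surfaceE n (a s : R) (A : set (borel_rV R n.+1)) :
  s ^+ 2 = 1 -> measurable A ->
  (graph_surface [set u : 'rV[R]_n | (l1norm u < 1)%R] (fun u => a + s * l1norm u)%R A =
  (Num.sqrt n.+1%:R)%:E * \int[mpow lebesgue_measure n]_u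
     ((\1_[set u : borel_rV R n | (l1norm (u : 'rV[R]_n) < 1)%R] u)%:E *
      (\1_A (consv (a + s * l1norm (u : 'rV[R]_n), u)%R))%:E))%E.
Proof.
move=> s2 mA; rewrite /graph_surface.
have ml := @measurable_l1norm R n.
have mint : measurable_fun setT (fun u : borel_rV R n =>
     ((\1_[set u : borel_rV R n | (l1norm (u : 'rV[R]_n) < 1)%R] u)%:E *
      (\1_A (consv (a + s * l1norm (u : 'rV[R]_n), u)%R))%:E : \bar R)%E).
  apply: emeasurable_funM.
    by apply/measurable_EFinP; apply: measurable_indic; exact: measurable_ltr_set.
  apply/measurable_EFinP; apply: measurableT_comp; first exact: measurable_indic.
  apply: (measurableT_comp (@measurable_consv R n)).
  apply: measurable_fun_pair => //.
  by apply: measurable_funD => //; exact: measurable_funM.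
rewrite -ge0_integralZl//.
apply: lebesgue_integral_rV_off_hyperplanes.
- exact: emeasurable_funM.
- by move=> u; rewrite !mule_ge0// lee_fin// sqrtr_ge0.
- by move=> u; rewrite lee_fin !mulr_ge0// sqrtr_ge0.
move=> u u0; rewrite -!EFinM mulrC; congr (Num.sqrt _ * _)%:E.
rewrite -natr1 addrC; congr (_ + 1).
rewrite /l2norm sqr_sqrtr; last by apply: sumr_ge0 => i _; exact: sqr_ge0.
rewrite -[in RHS](card_ord n) -sum1_card natr_sum; apply: eq_bigr => i _.
rewrite mxE derive_l1norm// exprMn s2 mul1r.
by rewrite sqr_sg u0.
Qed.

Lemma l1sphere_surfaceE n (A : set (borel_rV R n.+1)) : measurable A ->
  (l1sphere_surface (A : set 'rV[R]_n.+1) =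
   (Num.sqrt n.+1%:R)%:E * surface_integral (fun x => (\1_A x)%:E))%E.
Proof.
move=> mA; rewrite /l1sphere_surface /surface_integral.
have -> : (fun u : 'rV[R]_n => 1 - l1norm u) = (fun u => 1 + -1 * l1norm u).
  by apply/funext => u; rewrite mulN1r.
have -> : (fun u : 'rV[R]_n => l1norm u - 1) = (fun u => -1 + 1 * l1norm u).
  by apply/funext => u; rewrite mul1r addrC.
rewrite !graph_surfaceE ?expr1n ?sqrrN ?expr1n//.
rewrite -ge0_muleDr; last 2 first.
- by apply: integral_ge0 => u _; rewrite mule_ge0// lee_fin.
- by apply: integral_ge0 => u _; rewrite mule_ge0// lee_fin.
congr (_ * (_ + _))%E; apply: eq_integral => u _.
  by rewrite mulN1r.
by rewrite mul1r addrC.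
Qed.

End surface.

(** * The uniform law as the image of a Laplace vector *)

Section law.
Context {R : realType}.
Local Notation lap n := (mpow (@laplace_prob R) n).

Lemma mpow_setT (m : {sigma_finite_measure set (measurableTypeR R) -> \bar R}) n :
  m setT = 1%E -> mpow m n setT = 1%E.
Proof.
move=> m1; elim: n => [|n IH]; first by rewrite /= diracT.
rewrite -[LHS]mul1e -integral_cst// ge0_integral_mpowS//.
transitivity (\int[m]_t 1)%E.
  by apply: eq_integral => t _; rewrite integral_cst// mul1e; exact: IH.
by rewrite integral_cst// mul1e; exact: m1.
Qed.

Lemma laplace_polar_weight n k (w : measurableTypeR R -> R)
    (phi : borel_rV R n.+1 -> \bar R) :
  measurable_fun setT w -> (forall r, 0 <= w r) ->
  (forall r, 0 < r -> r ^+ n * w r = r ^+ k) ->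
  measurable_fun setT phi -> (forall x, 0 <= phi x)%E ->
  (\int[lap n.+1]_x ((w (l1norm (x : 'rV[R]_n.+1)))%:E * phi (l1proj x)) =
   (2^-1 ^+ n.+1 * k`!%:R)%:E * surface_integral phi)%E.
Proof.
move=> mw w0 wk mphi phi0; rewrite laplace_polar//; congr (_ * _)%E.
rewrite [RHS]EFinM -gamma_integral; congr (_ * _)%E; apply: eq_integral => r.
by rewrite inE /= in_itv /= andbT => r0; rewrite wk.
Qed.

Lemma integral_l1proj n (phi : borel_rV R n.+1 -> \bar R) :
  measurable_fun setT phi -> (forall x, 0 <= phi x)%E ->
  (\int[lap n.+1]_x phi (l1proj x) =
   (2^-1 ^+ n.+1 * n`!%:R)%:E * surface_integral phi)%E.
Proof.
move=> mphi phi0; rewrite -(@laplace_polar_weight _ n (cst 1))//.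
  by apply: eq_integral => x _; rewrite mul1e.
by move=> r _; rewrite mulr1.
Qed.

(** Independence of |X|_1 and N X, for the radial weights used below: |X|_1 has the
Gamma distribution with density r ^ n exp (- r) / n!, and the mean of a weight
[w] with r ^ n w r = r ^ k is k! / n!. *)
Lemma integral_l1proj_weight n k (w : measurableTypeR R -> R)
    (phi : borel_rV R n.+1 -> \bar R) :
  measurable_fun setT w -> (forall r, 0 <= w r) ->
  (forall r, 0 < r -> r ^+ n * w r = r ^+ k) ->
  measurable_fun setT phi -> (forall x, 0 <= phi x)%E ->
  (\int[lap n.+1]_x ((w (l1norm (x : 'rV[R]_n.+1)))%:E * phi (l1proj x)) =
   (k`!%:R / n`!%:R)%:E * \int[lap n.+1]_x phi (l1proj x))%E.
Proof.
move=> mw w0 wk mphi phi0; rewrite (laplace_polar_weight mw w0 wk)//.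
rewrite integral_l1proj// muleA -EFinM; congr (_%:E * _)%E.
have f0 : n`!%:R != 0 :> R by rewrite pnatr_eq0 -lt0n fact_gt0.
by field.
Qed.

(** The normalization is read off from the total mass 1 of the Laplace law; the
volume of the simplex is not computed. *)
Lemma surface_integral_cst1 n :
  (surface_integral (n := n) (fun=> 1) = ((2^-1 ^+ n.+1 * n`!%:R)^-1 : R)%:E :> \bar R)%E.
Proof.
have cgt0 : 0 < 2^-1 ^+ n.+1 * n`!%:R :> R.
  by rewrite mulr_gt0 ?exprn_gt0 ?ltr0n ?fact_gt0// invr_gt0.
have c0 := lt0r_neq0 cgt0.
have := @integral_l1proj n (fun=> 1%E) (measurable_cst _) (fun=> lee01).
have -> : (\int[lap n.+1]_x 1 = 1 :> \bar R)%E.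
  by rewrite integral_cst// mul1e; apply: mpow_setT; exact: probability_setT.
case: (surface_integral _) => [r| |].
- by rewrite -EFinM => -[] h; congr EFin; apply: (mulfI c0); rewrite mulfV.
- by rewrite gt0_muley// lte_fin.
- by rewrite gt0_muleNy// lte_fin.
Qed.

Context (dO : measure_display) (Omega : measurableType dO) (P : probability Omega R).
Variables (n : nat) (zeta : {RV P >-> borel_rV R n.+1}).
Hypothesis hzeta : uniform_on_l1sphere zeta.

Lemma surface_integral_l1sphere :
  (surface_integral (fun x => (\1_(@l1sphere R n.+1) x)%:E) = surface_integral (n := n) (fun=> 1))%E.
Proof.
have aux (u : borel_rV R n) (t : R) :
    (l1norm (u : 'rV[R]_n) < 1 -> `|t| + l1norm (u : 'rV[R]_n) = 1) ->
    ((\1_[set v : borel_rV R n | (l1norm (v : 'rV[R]_n) < 1)%R] u)%:E *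
      (\1_(@l1sphere R n.+1) (consv (t, u)))%:E =
    (\1_[set v : borel_rV R n | (l1norm (v : 'rV[R]_n) < 1)%R] u)%:E * 1 :> \bar R)%E.
  move=> tu; rewrite 2!indicE; have [uD|uD] := ltP (l1norm (u : 'rV[R]_n)) 1.
    by rewrite [consv _ \in _]mem_set// /l1sphere /= l1norm_consv tu.
  by rewrite memNset /= ?mul0e//; apply/negP; rewrite -leNgt.
congr (_ + _)%E; apply: eq_integral => u _; apply: aux => u1.
  by rewrite ger0_norm ?subrK// subr_ge0 ltW.
by rewrite ler0_norm ?opprB ?subrK// subr_le0 ltW.
Qed.

(** Both sides are the normalized surface integral of the indicator of [A]. *)
Lemma uniform_law (A : set (borel_rV R n.+1)) : measurable A ->
  distribution P zeta A = pushforward (lap n.+1) (@l1proj R n.+1) A.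
Proof.
move=> mA; rewrite hzeta//.
have mS : measurable (@l1sphere R n.+1 : set (borel_rV R n.+1)).
  rewrite (_ : @l1sphere R n.+1 = (fun x : borel_rV R n.+1 => l1norm (x : 'rV[R]_n.+1)) @^-1` [set 1])//.
  rewrite -[X in measurable X]setTI; exact: measurable_l1norm.
rewrite !l1sphere_surfaceE// surface_integral_l1sphere surface_integral_cst1.
have mi : measurable_fun setT (fun x : borel_rV R n.+1 => (\1_A x)%:E : \bar R).
  by apply/measurable_EFinP; exact: measurable_indic.
have i0 x : (0 <= (\1_A (x : borel_rV R n.+1))%:E :> \bar R)%E by rewrite lee_fin.
have E := integral_l1proj mi i0.
transitivity (\int[lap n.+1]_x (\1_A (l1proj x))%:E)%E; last first.
  have mpre : measurable (@l1proj R n.+1 @^-1` A).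
    by rewrite -[X in measurable X]setTI; exact: measurable_l1proj.
  by rewrite -[RHS]/(lap n.+1 _) -[X in lap n.+1 X]setIT -integral_indic.
rewrite E.
have c0 : 0 < 2^-1 ^+ n.+1 * n`!%:R :> R.
  by rewrite mulr_gt0 ?exprn_gt0 ?ltr0n ?fact_gt0// invr_gt0.
have s0 : 0 < Num.sqrt n.+1%:R :> R by rewrite sqrtr_gt0.
rewrite -EFinM inver gt_eqF ?mulr_gt0 ?invr_gt0//.
rewrite muleAC -EFinM; congr (_%:E * _)%E.
by field; rewrite !gt_eqF.
Qed.

Lemma ge0_integral_uniform (phi : borel_rV R n.+1 -> \bar R) :
  measurable_fun setT phi -> (forall x, 0 <= phi x)%E ->
  (\int[P]_w phi (zeta w) = \int[lap n.+1]_x phi (l1proj x))%E.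
Proof.
move=> mphi phi0; rewrite -[LHS](ge0_integral_distribution zeta mphi)//.
pose Q : {measure set (borel_rV R n.+1) -> \bar R} :=
  measure_function_pushforward__canonical__measure_function_Measure
    (lap n.+1) (@measurable_l1proj R n.+1).
transitivity (\int[Q]_x phi x)%E.
  by apply: eq_measure_integral => A mA _; exact: uniform_law.
by rewrite (ge0_integral_pushforward (@measurable_l1proj R n.+1) _ measurableT mphi).
Qed.

Lemma integral_uniform (g : borel_rV R n.+1 -> \bar R) : measurable_fun setT g ->
  (\int[P]_w (g \o zeta) w = \int[lap n.+1]_y (g \o @l1proj R n.+1) y)%E.
Proof.
move=> mg; rewrite [LHS]integralE [RHS]integralE.
rewrite (funepos_comp g zeta) (funeneg_comp g zeta).
rewrite (funepos_comp g (@l1proj R n.+1)) (funeneg_comp g (@l1proj R n.+1)).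
congr (_ - _)%E.
  exact: (ge0_integral_uniform (measurable_funepos mg) (funepos_ge0 _)).
exact: (ge0_integral_uniform (measurable_funeneg mg) (funeneg_ge0 _)).
Qed.

Lemma variance_uniform (G : borel_rV R n.+1 -> R) : measurable_fun setT G ->
  ('V_P[fun w => G (zeta w)] =
  \int[lap n.+1]_x ((G (l1proj x) - fine (\int[lap n.+1]_y (G (l1proj y))%:E)) ^+ 2)%:E)%E.
Proof.
move=> mG; have mGE : measurable_fun setT (EFin \o G) by exact/measurable_EFinP.
rewrite /variance covariance.unlock.
have -> : ('E_P[fun w => G (zeta w)] = \int[lap n.+1]_y (G (l1proj y))%:E)%E.
  by rewrite -(integral_uniform mGE) expectation.unlock.
set c := fine _; rewrite expectation.unlock.
have mGc : measurable_fun setT (fun x : borel_rV R n.+1 => ((G x - c) ^+ 2)%:E).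
  by apply/measurable_EFinP; apply: measurable_funX; exact: measurable_funB.
rewrite -[RHS](integral_uniform mGc).
by apply: eq_integral => w _.
Qed.

End law.

(** * Tensorization of the variance *)

Section two_factors.
Local Open Scope ereal_scope.
Context {R : realType}.

Lemma bounded_integrable d (T : measurableType d) (mu : {measure set T -> \bar R})
    (f : T -> R) (B : R) :
  mu setT = 1 -> measurable_fun setT f -> (forall x, `|f x| <= B)%R ->
  mu.-integrable setT (EFin \o f).
Proof.
move=> mu1 mf fB; apply: measurable_bounded_integrable => //.
  rewrite [X in X < _]mu1; exact: ltry.
by exists B; split; [exact: num_real|move=> x Bx y _; rewrite /= (le_trans (fB y))// ltW].
Qed.

Lemma integral_bound d (T : measurableType d) (mu : {measure set T -> \bar R})
    (f : T -> R) (B : R) :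
  mu setT = 1 -> measurable_fun setT f -> (forall x, `|f x| <= B)%R ->
  (`|fine (\int[mu]_x (f x)%:E)| <= B)%R.
Proof.
move=> mu1 mf fB.
have fi := bounded_integrable mu1 mf fB.
rewrite -lee_fin -fine_abse ?fineK ?abse_fin_num; try exact: integrable_fin_num.
apply: (le_trans (le_abse_integral _ _ _)) => //; first exact: (measurable_int mu).
apply: (@le_trans _ _ (\int[mu]_x B%:E)).
  by apply: ge0_le_integral => //; [exact/measurableT_comp/measurable_EFinP
    |move=> x _; rewrite lee_fin].
by rewrite integral_cst// [X in _ * X]mu1 mule1.
Qed.

(** The variance on an arbitrary measure space, for functions that need not be
random variables of a given probability; the mean is meant to be finite. *)
Definition variance_of d (T : measurableType d) (mu : {measure set T -> \bar R}) (f : T -> R) :=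
  \int[mu]_x ((f x - fine (\int[mu]_y (f y)%:E)) ^+ 2)%:E.

Context d1 d2 (T1 : measurableType d1) (T2 : measurableType d2).
Variables (m1 : {sigma_finite_measure set T1 -> \bar R})
          (m2 : {sigma_finite_measure set T2 -> \bar R}).
Hypotheses (m11 : m1 setT = 1) (m21 : m2 setT = 1).
Variables (f : T1 * T2 -> R) (B : R).
Hypotheses (mf : measurable_fun setT f) (fB : forall p, (`|f p| <= B)%R).

Let m12 : (m1 \x m2) setT = 1.
Proof. rewrite -setXTT product_measure1E//; transitivity (1 * 1 : \bar R); last by rewrite mule1.
by congr (_ * _); [exact: m11|exact: m21]. Qed.

(** Let a and b be the means of f over the first and over the second factor, and M
its mean. As b - M and a - M are uncorrelated, the difference of the two sides
is the integral of (f - a - b + M) ^ 2. *)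
Lemma variance_two_factors :
  variance_of (m1 \x m2) f <=
  \int[m2]_y variance_of m1 (fun x => f (x, y)) +
  \int[m1]_x variance_of m2 (fun y => f (x, y)).
Proof.
set M := fine (\int[m1 \x m2]_p (f p)%:E).
pose a y := fine (\int[m1]_x (f (x, y))%:E).
pose b x := fine (\int[m2]_y (f (x, y))%:E).
have fi : (m1 \x m2).-integrable setT (EFin \o f) by exact: bounded_integrable fB.
have mfx x : measurable_fun setT (fun y => f (x, y)).
  exact: (measurableT_comp mf (measurable_pair1 x)).
have mfy y : measurable_fun setT (fun x => f (x, y)).
  exact: (measurableT_comp mf (measurable_pair2 y)).
have ma : measurable_fun setT a.
  apply: (measurableT_comp (fine_measurable measurableT)).
  exact: (measurable_fubini_G fi).
have mb : measurable_fun setT b.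
  apply: (measurableT_comp (fine_measurable measurableT)).
  exact: (measurable_fubini_F fi).
have aB y : (`|a y| <= B)%R by exact: integral_bound.
have bB x : (`|b x| <= B)%R by exact: integral_bound.
have MB : (`|M| <= B)%R by exact: integral_bound.
have fiB : \int[m1 \x m2]_p (f p)%:E = M%:E.
  by rewrite fineK//; exact: integrable_fin_num.
have intb : \int[m1]_x (b x)%:E = M%:E.
  rewrite -fiB -(integral12_prod_meas1 fi); apply: eq_integral => x _.
  rewrite fineK//; apply: integrable_fin_num => //.
  exact: (bounded_integrable (B := B)).
have inta : \int[m2]_y (a y)%:E = M%:E.
  rewrite -fiB -(integral21_prod_meas1 fi); apply: eq_integral => y _.
  rewrite fineK//; apply: integrable_fin_num => //.
  exact: (bounded_integrable (B := B)).
have cross : \int[m1 \x m2]_p ((b p.1 - M) * (a p.2 - M))%:E = 0.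
  pose g p := ((b p.1 - M) * (a p.2 - M))%R.
  have mg : measurable_fun setT g.
    apply: measurable_funM; apply: measurable_funB => //.
      exact: (measurableT_comp mb measurable_fst).
    exact: (measurableT_comp ma measurable_snd).
  have gi : (m1 \x m2).-integrable setT (EFin \o g).
    apply: (@bounded_integrable _ _ _ _ ((B + B) * (B + B))%R) => // p.
    by rewrite normrM ler_pM// (le_trans (ler_normB _ _))// lerD.
  rewrite -[LHS](integral12_prod_meas1 gi) integral0_eq// => x _.
  rewrite /fubini_F /=.
  have ai : m2.-integrable setT (EFin \o a) by exact: (bounded_integrable (B := B)).
  have Mi : m2.-integrable setT (EFin \o cst M) by exact: (bounded_integrable (B := B)).
  transitivity (\int[m2]_y ((b x - M)%:E * ((EFin \o a) \- (EFin \o cst M)) y)).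
    by apply: eq_integral => y _; rewrite /g /= -EFinB -EFinM.
  rewrite integralZl//; last exact: integrableB.
  rewrite integralB//= inta integral_cst// [X in _ - _ * X]m21 mule1 subee// mule0.
  by [].
pose p2 p := ((f p - M) ^+ 2)%R.
pose A p := ((f p - a p.2) ^+ 2)%R.
pose C p := ((f p - b p.1) ^+ 2)%R.
pose g p := ((b p.1 - M) * (a p.2 - M))%R.
have ma' : measurable_fun setT (fun p : T1 * T2 => a p.2).
  exact: (measurableT_comp ma measurable_snd).
have mb' : measurable_fun setT (fun p : T1 * T2 => b p.1).
  exact: (measurableT_comp mb measurable_fst).
have mp2 : measurable_fun setT p2.
  by apply: measurable_funX; exact: measurable_funB.
have mA : measurable_fun setT A.
  by apply: measurable_funX; exact: measurable_funB.
have mC : measurable_fun setT C.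
  by apply: measurable_funX; exact: measurable_funB.
have mg : measurable_fun setT g.
  by apply: measurable_funM; exact: measurable_funB.
have sqB (u v : R) : (`|u| <= B -> `|v| <= B -> `|(u - v) ^+ 2| <= (B + B) * (B + B))%R.
  by move=> uB vB; rewrite expr2 normrM ler_pM// (le_trans (ler_normB _ _))// lerD.
have p2i : (m1 \x m2).-integrable setT (EFin \o p2).
  by apply: (bounded_integrable (B := ((B + B) * (B + B))%R)) => // p; exact: sqB.
have Ai : (m1 \x m2).-integrable setT (EFin \o A).
  by apply: (bounded_integrable (B := ((B + B) * (B + B))%R)) => // p; exact: sqB.
have Ci : (m1 \x m2).-integrable setT (EFin \o C).
  by apply: (bounded_integrable (B := ((B + B) * (B + B))%R)) => // p; exact: sqB.
have gi : (m1 \x m2).-integrable setT (EFin \o g).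
  apply: (bounded_integrable (B := ((B + B) * (B + B))%R)) => // p.
  by rewrite normrM ler_pM// (le_trans (ler_normB _ _))// lerD.
have -> : \int[m2]_y variance_of m1 (fun x => f (x, y)) = \int[m1 \x m2]_p (A p)%:E.
  rewrite (@fubini_tonelli2 _ _ _ _ _ m1 m2 (EFin \o A))//; first exact/measurable_EFinP.
  by move=> p; rewrite lee_fin sqr_ge0.
have -> : \int[m1]_x variance_of m2 (fun y => f (x, y)) = \int[m1 \x m2]_p (C p)%:E.
  rewrite (@fubini_tonelli1 _ _ _ _ _ m1 m2 (EFin \o C))//; first exact/measurable_EFinP.
  by move=> p; rewrite lee_fin sqr_ge0.
rewrite -ge0_integralD//; last 4 first.
- by move=> p _; rewrite lee_fin sqr_ge0.
- exact/measurable_EFinP.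
- by move=> p _; rewrite lee_fin sqr_ge0.
- exact/measurable_EFinP.
have g2i : (m1 \x m2).-integrable setT (fun p => (- 2 : R)%:E * (EFin \o g) p).
  exact: integrableZl.
have -> : variance_of (m1 \x m2) f =
    \int[m1 \x m2]_p ((EFin \o p2) \+ (fun p => (- 2 : R)%:E * (EFin \o g) p)) p.
  by rewrite integralD// integralZl// cross mule0 adde0.
apply: le_integral => //; [exact: integrableD|exact: integrableD|].
move=> p _; rewrite /= -EFinM -!EFinD lee_fin -subr_ge0.
have -> : (A p + C p - (p2 p + (- 2) * g p) = (f p - a p.2 - b p.1 + M) ^+ 2)%R.
  by rewrite /A /C /p2 /g; ring.
exact: sqr_ge0.
Qed.

End two_factors.

Lemma ae_imply d (T : measurableType d) (R : realType) (mu : set T -> \bar R)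
    (P Q : T -> Prop) : (forall x, P x -> Q x) ->
  {ae mu, forall x, P x} -> {ae mu, forall x, Q x}.
Proof.
move=> PQ [N [mN muN PN]]; exists N; split => //.
by apply: subset_trans PN => x /=; apply: contra_not; exact: PQ.
Qed.

Section tensorization.
Context {R : realType}.

(** The line through [x] in direction [i], parametrized by the i-th coordinate. *)
Definition upd n (x : 'rV[R]_n) (i : 'I_n) (t : R) : borel_rV R n :=
  \row_j (if j == i then t else x 0 j).

Lemma upd_consv0 n s (u : borel_rV R n) t :
  upd (consv (s, u) : 'rV[R]_n.+1) ord0 t = consv (t, u).
Proof.
apply/rowP => i; rewrite mxE; have [j ->|->] := unliftP ord0 i.
  by rewrite !consvS.
by rewrite eqxx consv0.
Qed.

Lemma upd_consvS n s (u : borel_rV R n) j t :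
  upd (consv (s, u) : 'rV[R]_n.+1) (lift ord0 j) t = consv (s, upd (u : 'rV[R]_n) j t).
Proof.
apply/rowP => i; rewrite mxE; have [k ->|->] := unliftP ord0 i.
  by rewrite !consvS /= mxE (inj_eq lift_inj).
by rewrite (negbTE (neq_lift _ _)) !consv0.
Qed.

Definition off_hyperplanes n : set (borel_rV R n) :=
  [set x | forall i, (x : 'rV[R]_n) 0 i != 0].

Lemma measurable_off_hyperplanes n : measurable (@off_hyperplanes n).
Proof.
have -> : @off_hyperplanes n = \bigcap_(i in [set: 'I_n])
    ((fun x : borel_rV R n => (x : 'rV[R]_n) 0 i) @^-1` (~` [set 0])).
  apply/seteqP; split=> x /= h i; first by move=> _ /=; apply/eqP; exact: h.
  by apply/eqP; exact: h.
apply: fin_bigcap_measurable => // i _.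
rewrite -[X in measurable X]setTI; apply: measurable_coord => //.
exact: measurableC.
Qed.

Lemma off_hyperplanes_consv n t (u : borel_rV R n) :
  off_hyperplanes (consv (t, u)) <-> t != 0 /\ off_hyperplanes u.
Proof.
split=> [h|[t0 h] i].
  split; first by have := h ord0; rewrite consv0.
  by move=> i; have := h (lift ord0 i); rewrite consvS.
by have [j ->|->] := unliftP ord0 i; rewrite ?consvS ?consv0.
Qed.

Variable m : probability (measurableTypeR R) R.
Hypothesis m0 : m [set 0] = 0%E.
Local Open Scope ereal_scope.

Lemma ae_neq0 : {ae m, forall t, t != 0%R}.
Proof.
exists [set 0%R]; split => // t /= /negP; rewrite negbK => /eqP ->.
by [].
Qed.

Lemma mpow1 n : mpow m n setT = 1.
Proof. by apply: mpow_setT; exact: probability_setT. Qed.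

Lemma prod_mpow1 n : (m \x mpow m n) setT = 1.
Proof.
rewrite -setXTT product_measure1E//; transitivity (1 * 1 : \bar R); last by rewrite mule1.
by congr (_ * _); [exact: probability_setT|exact: mpow1].
Qed.

Lemma ae_off_hyperplanes n : {ae mpow m n, forall x, off_hyperplanes x}.
Proof.
exists (~` @off_hyperplanes n); split => //.
  by apply: measurableC; exact: measurable_off_hyperplanes.
elim: n => [|n IH].
  rewrite (_ : ~` _ = set0) ?measure0//; apply/seteqP; split=> // x /= h.
  by apply: h; case.
have mN k : measurable (~` @off_hyperplanes k).
  by apply: measurableC; exact: measurable_off_hyperplanes.
rewrite -[X in mpow m n.+1 X]setIT -integral_indic//.
have mind k : measurable_fun setT
    (fun x : borel_rV R k => (\1_(~` @off_hyperplanes k) x)%:E : \bar R).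
  by apply/measurable_EFinP; exact: measurable_indic.
have ind0 k (x : borel_rV R k) : 0 <= (\1_(~` @off_hyperplanes k) x)%:E :> \bar R.
  by rewrite lee_fin.
rewrite ge0_integral_mpowS//.
transitivity (\int[m]_t (0 : \bar R)); last by rewrite integral0.
apply: ae_eq_integral => //.
  exact: (measurable_integral_consvr m (mind n.+1)).
apply: ae_imply _ ae_neq0 => t t0 _.
transitivity (\int[mpow m n]_u (\1_(~` @off_hyperplanes n) u)%:E); last first.
  by rewrite integral_indic// setIT.
apply: eq_integral => u _; rewrite !indicE.
congr ((nat_of_bool _)%:R%:E); apply/idP/idP; rewrite !inE /= => h; apply: contra_not h.
  by move=> h; apply/off_hyperplanes_consv.
by move=> /off_hyperplanes_consv[].
Qed.

(** A power of a measure is by construction the image of a product. *)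
Lemma variance_of_consv n (F : borel_rV R n.+1 -> R) (B : R) :
  measurable_fun setT F -> (forall x, (`|F x| <= B)%R) ->
  variance_of (mpow m n.+1) F = variance_of (m \x mpow m n) (F \o @consv R n).
Proof.
move=> mF FB.
have mFc : measurable_fun setT (F \o @consv R n).
  exact: (measurableT_comp mF (@measurable_consv R n)).
rewrite /variance_of.
have -> : \int[mpow m n.+1]_x (F x)%:E = \int[m \x mpow m n]_p ((F \o @consv R n) p)%:E.
  apply: (@integral_pushforward _ _ _ _ _ _ (@measurable_consv R n) _ setT (EFin \o F)) => //.
    exact/measurable_EFinP.
  rewrite preimage_setT; apply: (bounded_integrable (B := B)) => //.
  exact: prod_mpow1.
set c := fine _.
apply: (ge0_integral_pushforward (@measurable_consv R n) (m \x mpow m n)%E measurableT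
  (f := fun x => ((F x - c) ^+ 2)%:E)).
  by apply/measurable_EFinP; apply: measurable_funX; exact: measurable_funB.
by move=> x _; rewrite lee_fin sqr_ge0.
Qed.

(** Induction on the dimension with [variance_two_factors]. The bound on the lines
is required off the coordinate hyperplanes only: they are null sets when [m]
has no atom at 0, and the lines inside them may run through the origin, where
the normalized function is discontinuous. *)
Theorem variance_tensorization n (F : borel_rV R n -> R) (B : R)
    (D : 'I_n -> borel_rV R n -> \bar R) :
  measurable_fun setT F -> (forall x, (`|F x| <= B)%R) ->
  (forall i, measurable_fun setT (D i)) -> (forall i x, 0 <= D i x) ->
  (forall i x, off_hyperplanes x ->
    variance_of m (fun t => F (upd (x : 'rV[R]_n) i t)) <=
    \int[m]_t D i (upd (x : 'rV[R]_n) i t)) ->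
  variance_of (mpow m n) F <= \sum_(i < n) \int[mpow m n]_x D i x.
Proof.
elim: n F D => [|n IH] F D mF FB mD D0 FD.
  rewrite big_ord0 /variance_of ge0_integral_mpow0; last first.
    by move=> x; rewrite lee_fin sqr_ge0.
  have -> : \int[mpow m 0]_y (F y)%:E = (F (0%R : 'rV[R]_0))%:E.
    by rewrite /= integral_dirac ?diracT ?mul1e//; exact/measurable_EFinP.
  by rewrite subrr expr0n.
rewrite (variance_of_consv mF FB).
have mFc : measurable_fun setT (F \o @consv R n).
  exact: (measurableT_comp mF (@measurable_consv R n)).
have Fi : (m \x mpow m n).-integrable setT (EFin \o (F \o @consv R n)).
  by apply: (bounded_integrable (B := B)) => [||p] //; [exact: prod_mpow1|exact: FB].
have FcB p : (`|(F \o @consv R n) p| <= B)%R by exact: FB.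
apply: (le_trans (variance_two_factors (probability_setT m) (mpow1 n) mFc FcB)).
rewrite big_ord_recl; apply: leeD.
  rewrite ge0_integral_mpowS_swap//.
  apply: ae_ge0_le_integral => //.
  - by move=> u _; apply: integral_ge0 => t _; rewrite lee_fin sqr_ge0.
  - pose a (u : borel_rV R n) := fine (\int[m]_t (F (consv (t, u)))%:E).
    have ma : measurable_fun setT a.
      apply: (measurableT_comp (fine_measurable measurableT)).
      exact: (measurable_fubini_G Fi).
    pose H (x : borel_rV R n.+1) := ((F x - a (tailv x)) ^+ 2)%:E.
    have mH : measurable_fun setT H.
      apply/measurable_EFinP; apply: measurable_funX; apply: measurable_funB => //.
      exact: (measurableT_comp ma (@measurable_tailv R n)).
    have H0 x : 0 <= H x by rewrite lee_fin sqr_ge0.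
    apply: eq_measurable_fun (measurable_integral_consvl m mH H0) => u _.
    by apply: eq_integral => t _; rewrite /H tailv_consv.
  - by move=> u _; exact: integral_ge0.
  - exact: measurable_integral_consvl.
  apply: ae_imply _ (ae_off_hyperplanes n) => u u0 _ /=.
  have u1 : off_hyperplanes (consv (1%R, u)).
    by apply/off_hyperplanes_consv; split => //; exact: oner_neq0.
  have E t : upd (consv (1%R, u) : 'rV[R]_n.+1) ord0 t = consv (t, u).
    exact: upd_consv0.
  apply: le_trans (le_trans (FD ord0 _ u1) _).
    rewrite (_ : (fun t => F (upd _ ord0 t)) = (fun t => F (consv (t, u))))//.
    by apply/funext => t; rewrite E.
  by under eq_integral do rewrite E.
have mDt i t : measurable_fun setT (fun u => D (lift ord0 i) (consv (t, u))).
  exact: (measurableT_comp (mD _) (@measurable_consvr R n t)).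
apply: (@le_trans _ _ (\int[m]_t \sum_(i < n) \int[mpow m n]_u D (lift ord0 i) (consv (t, u)))).
  apply: ae_ge0_le_integral => //.
  - by move=> t _; apply: integral_ge0 => u _; rewrite lee_fin sqr_ge0.
  - pose b (t : measurableTypeR R) := fine (\int[mpow m n]_u (F (consv (t, u)))%:E).
    have mb : measurable_fun setT b.
      apply: (measurableT_comp (fine_measurable measurableT)).
      exact: (measurable_fubini_F Fi).
    pose H (x : borel_rV R n.+1) := ((F x - b (headv x)) ^+ 2)%:E.
    have mH : measurable_fun setT H.
      apply/measurable_EFinP; apply: measurable_funX; apply: measurable_funB => //.
      exact: (measurableT_comp mb (@measurable_headv R n)).
    have H0 x : 0 <= H x by rewrite lee_fin sqr_ge0.
    apply: eq_measurable_fun (measurable_integral_consvr m mH H0) => t _.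
    by apply: eq_integral => u _; rewrite /H headv_consv.
  - by move=> t _; apply: sume_ge0 => i _; exact: integral_ge0.
  - by apply: emeasurable_sum => i; exact: measurable_integral_consvr.
  apply: ae_imply _ ae_neq0 => t t0 _ /=.
  apply: (IH (fun u => F (consv (t, u))) (fun i u => D (lift ord0 i) (consv (t, u)))) => //.
    exact: (measurableT_comp mF (@measurable_consvr R n t)).
  move=> i u u0.
  have tu : off_hyperplanes (consv (t, u)) by apply/off_hyperplanes_consv.
  have E s : upd (consv (t, u) : 'rV[R]_n.+1) (lift ord0 i) s = consv (t, upd (u : 'rV[R]_n) i s).
    exact: upd_consvS.
  apply: le_trans (le_trans (FD (lift ord0 i) _ tu) _).
    rewrite (_ : (fun s => F (upd _ (lift ord0 i) s)) =
                 (fun s => F (consv (t, upd (u : 'rV[R]_n) i s))))//.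
    by apply/funext => s; rewrite E.
  by under eq_integral do rewrite E.
rewrite ge0_integral_sum//; last 2 first.
- by move=> i; exact: measurable_integral_consvr.
- by move=> i t _; exact: integral_ge0.
by apply: lee_sum => i _; rewrite ge0_integral_mpowS.
Qed.

End tensorization.

(** * Poincare inequality for the Laplace distribution *)

Section half_line.
Context {R : realType}.
Variables (f g : R -> R).
Hypothesis fg : forall t : R, 0 <= t -> is_derive t 1 f (g t).
Hypothesis cg : forall t : R, 0 <= t -> {for t, continuous g}.

Let h t := f t - f 0.
Let e (t : R) := expR (- t).

Let ce (t : R) : {for t, continuous e}.
Proof.
by apply: continuous_comp; [apply: cvgN; exact: cvg_id|exact: continuous_expR].
Qed.

Let cf (t : R) : 0 <= t -> {for t, continuous f}.
Proof.
move=> t0; apply/differentiable_continuous/derivable1_diffP.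
by have [] := fg t0.
Qed.

Let ch (t : R) : 0 <= t -> {for t, continuous h}.
Proof. by move=> t0; apply: cvgB; [exact: cf|exact: cvg_cst]. Qed.

Let psi t := (2 * (h t * g t) - h t ^+ 2) * e t.

Let dPhi (t : R) : 0 <= t -> is_derive t 1 (fun x => h x ^+ 2 * e x) (psi t).
Proof.
move=> t0.
have dh : is_derive t 1 h (g t).
  by apply: (is_derive_eq (is_deriveB (fg t0) (is_derive_cst (f 0) t 1))); rewrite subr0.
have dE : is_derive t 1 e (- e t).
  by apply: is_derive_eq; rewrite mulrN1.
have -> : (fun x => h x ^+ 2 * e x) = (h * h) * e.
  by apply/funext => x /=; rewrite expr2.
apply: (is_derive_eq (is_deriveM (is_deriveM dh dh) dE)).
by rewrite /psi /GRing.scale /= -[(h * h) t]/(h t * h t); ring.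
Qed.

Let cu (t : R) : 0 <= t -> {for t, continuous (fun x => h x ^+ 2 * e x)}.
Proof.
by move=> t0; apply: cvgM; [apply: cvgM; exact: ch|exact: ce].
Qed.

Let cv (t : R) : 0 <= t -> {for t, continuous (fun x => 4 * g x ^+ 2 * e x)}.
Proof.
move=> t0; apply: cvgM; last exact: ce.
by apply: cvgM; [exact: cvg_cst|apply: cvgM; exact: cg].
Qed.

Let cpsi (t : R) : 0 <= t -> {for t, continuous psi}.
Proof.
move=> t0; apply: cvgM; last exact: ce.
apply: cvgB; last by apply: cvgM; exact: ch.
by apply: cvgM; [exact: cvg_cst|apply: cvgM; [exact: ch|exact: cg]].
Qed.

Let within_itv (k : R -> R) b : (forall t : R, 0 <= t -> {for t, continuous k}) ->
  {within `[0, b], continuous k}.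
Proof.
move=> ck; apply: continuous_in_subspaceT => t.
by rewrite inE /= in_itv /= => /andP[t0 _]; exact: ck.
Qed.

Let int_itv (k : R -> R) b : (forall t : R, 0 <= t -> {for t, continuous k}) ->
  lebesgue_measure.-integrable `[0, b] (EFin \o k).
Proof.
move=> ck; apply: continuous_compact_integrable; first exact: segment_compact.
exact: within_itv.
Qed.

Let itv_bound b : 0 < b ->
  (\int[lebesgue_measure]_(t in `[0%R, b]) (h t ^+ 2 * e t)%:E <=
   \int[lebesgue_measure]_(t in `[0%R, b]) (4 * g t ^+ 2 * e t)%:E)%E.
Proof.
move=> b0.
have Epsi : (\int[lebesgue_measure]_(t in `[0%R, b]) (psi t)%:E = (h b ^+ 2 * e b)%:E)%E.
  rewrite (@continuous_FTC2 _ _ (fun x => h x ^+ 2 * e x))//.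
  - by rewrite /h subrr expr0n mul0r sube0.
  - exact: within_itv.
  - split.
    + by move=> t; rewrite in_itv /= => /andP[/ltW t0 _]; have [] := dPhi t0.
    + by apply: cvg_at_right_filter; exact: cu.
    + by apply: cvg_at_left_filter; apply: cu; exact: ltW.
  - move=> t; rewrite in_itv /= => /andP[/ltW t0 _]; rewrite derive1E.
    by have /@derive_val -> := dPhi t0.
pose k t := h t ^+ 2 * e t + 2 * psi t.
have ck (t : R) : 0 <= t -> {for t, continuous k}.
  move=> t0; apply: cvgD; first exact: cu.
  by apply: cvgM; [exact: cvg_cst|exact: cpsi].
have i2 : lebesgue_measure.-integrable `[0, b] (fun t => (2 : R)%:E * (EFin \o psi) t)%E.
  by apply: integrableZl => //; exact: int_itv.
pose u1 : R -> \bar R := EFin \o (fun x => h x ^+ 2 * e x).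
apply: (@le_trans _ _ (\int[lebesgue_measure]_(t in `[0%R, b])
    (u1 t + (2 : R)%:E * (EFin \o psi) t))%E).
  rewrite integralD//; last exact: int_itv.
  rewrite integralZl//; last exact: int_itv.
  by rewrite [X in (_ * X)%E]Epsi leeDl// mule_ge0// lee_fin mulr_ge0 ?expR_ge0 ?sqr_ge0.
apply: le_integral => //.
- by apply: integrableD => //; exact: int_itv.
- exact: int_itv.
- move=> t _; rewrite /= -EFinM -EFinD lee_fin /psi -subr_ge0.
  have -> : 4 * g t ^+ 2 * e t - (h t ^+ 2 * e t + 2 * ((2 * (h t * g t) - h t ^+ 2) * e t))
     = (2 * g t - h t) ^+ 2 * e t by ring.
  by rewrite mulr_ge0 ?expR_ge0 ?sqr_ge0.
Qed.

(** Let h = f - f 0. The function h ^ 2 exp (- t) vanishes at 0 and has derivative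
psi = (2 h g - h ^ 2) exp (- t), so the integral of psi over [0, b] is
nonnegative. Pointwise
  h ^ 2 exp (- t) + 2 psi = (4 h g - h ^ 2) exp (- t) <= 4 g ^ 2 exp (- t),
because (2 g - h) ^ 2 >= 0. The comparison is made on [0, b] first since neither
side is known to be finite on the half line. *)
Lemma exponential_poincare :
  (\int[lebesgue_measure]_(t in `]0%R, +oo[) ((f t - f 0) ^+ 2 * expR (- t))%:E <=
   \int[lebesgue_measure]_(t in `]0%R, +oo[) (4 * g t ^+ 2 * expR (- t))%:E)%E.
Proof.
have mk (k : R -> R) : (forall t : R, 0 <= t -> {for t, continuous k}) ->
    measurable_fun (`]0, +oo[%classic : set (measurableTypeR R)) (EFin \o k).
  move=> ck; apply/measurable_EFinP; apply: open_continuous_measurable_fun => //.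
  by move=> t; rewrite inE /= in_itv /= andbT => /ltW; exact: ck.
rewrite [leLHS]integral_itv_obnd_cbnd; last exact: mk cu.
rewrite [leRHS]integral_itv_obnd_cbnd; last exact: mk cv.
have mk' (k : R -> R) (b : R) : (forall t : R, 0 <= t -> {for t, continuous k}) ->
    measurable_fun (`[0, b]%classic : set (measurableTypeR R)) (EFin \o k).
  by move=> /(@int_itv k b)/(measurable_int lebesgue_measure).
have nd : nondecreasing_seq (fun n => `[0, 0 + n%:R]%classic : set (measurableTypeR R)).
  move=> n m nm; apply/subsetPset => t; rewrite /= !in_itv /= => /andP[-> /le_trans->//].
  by rewrite !add0r ler_nat.
have mi n : measurable (`[0, 0 + n%:R]%classic : set (measurableTypeR R)) by [].
have lim : (\int[lebesgue_measure]_(t in `[0%R, (0 + n%:R)%R]) (h t ^+ 2 * e t)%:E @[n --> \oo] -->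
    \int[lebesgue_measure]_(t in `[0%R, +oo[) (h t ^+ 2 * e t)%:E)%E.
  rewrite itv_bndy_bigcup_BRight.
  refine (ge0_nondecreasing_set_cvg_integral nd mi (fun n => mk' _ _ cu) _).
  by move=> n t _; rewrite lee_fin mulr_ge0 ?expR_ge0 ?sqr_ge0.
rewrite -(cvg_lim _ lim)//.
apply: lime_le; first by apply/cvg_ex; eexists; exact: lim.
near=> n.
apply: (le_trans (itv_bound _)).
  by rewrite add0r ltr0n; near: n; exists 1%N.
apply: ge0_subset_integral => //.
- by apply/emeasurable_fun_itv_obnd_cbndP; exact: mk cv.
- by move=> t _; rewrite lee_fin mulr_ge0 ?expR_ge0// mulr_ge0// sqr_ge0.
- by move=> t; rewrite /= !in_itv /= => /andP[->].
Unshelve. all: by end_near. Qed.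
End half_line.

Section laplace_poincare.
Context {R : realType}.
Local Open Scope ereal_scope.

(** The mean minimizes the mean square distance to a constant. *)
Lemma variance_of_le d (T : measurableType d) (mu : {measure set T -> \bar R})
    (f : T -> R) (B c : R) :
  mu setT = 1 -> measurable_fun setT f -> (forall x, (`|f x| <= B)%R) ->
  variance_of mu f <= \int[mu]_x ((f x - c) ^+ 2)%:E.
Proof.
move=> mu1 mf fB; rewrite /variance_of.
have fi : mu.-integrable setT (EFin \o f) by exact: (bounded_integrable (B := B)).
have := integral_bound mu1 mf fB.
have : (fine (\int[mu]_x (f x)%:E))%:E = \int[mu]_x (f x)%:E.
  by rewrite fineK//; exact: integrable_fin_num.
set M := fine _ => ME MB.
have mc (a : R) : measurable_fun setT (fun x => (f x - a)%R).
  exact: measurable_funB.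
have i1 a : mu.-integrable setT (EFin \o (fun x => ((f x - a) ^+ 2)%R)).
  apply: (bounded_integrable (B := ((B + `|a|) * (B + `|a|))%R)) => //.
    exact: measurable_funX.
  by move=> x; rewrite expr2 normrM ler_pM// (le_trans (ler_normB _ _))// lerD.
have i2 : mu.-integrable setT (EFin \o (fun x => (f x - M)%R)).
  apply: (bounded_integrable (B := (B + B)%R)) => // x.
  by rewrite (le_trans (ler_normB _ _))// lerD.
have i3 : mu.-integrable setT (fun x => (2 * (M - c))%:E * (EFin \o (fun x => (f x - M)%R)) x).
  exact: integrableZl.
have E2 : \int[mu]_x (EFin \o (fun x => (f x - M)%R)) x = 0.
  have ci : mu.-integrable setT (EFin \o cst M) by exact: (bounded_integrable (B := `|M|)).
  rewrite [LHS](integralB_EFin measurableT fi ci) -ME.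
  have -> : \int[mu]_x (cst M x)%:E = M%:E.
    by rewrite -[LHS]/(\int[mu]_x (cst M%:E x)) integral_cst// [X in _ * X]mu1 mule1.
  by rewrite subee.
apply: (@le_trans _ _ (\int[mu]_x ((EFin \o (fun x => ((f x - M) ^+ 2)%R)) x +
    (2 * (M - c))%:E * (EFin \o (fun x => (f x - M)%R)) x))).
  by rewrite integralD// integralZl// E2 mule0 adde0.
apply: le_integral => //; [exact: integrableD|exact: i1|].
move=> x _; rewrite /= -EFinM -EFinD lee_fin -subr_ge0.
have -> : ((f x - c) ^+ 2 - ((f x - M) ^+ 2 + 2 * (M - c) * (f x - M)) = (M - c) ^+ 2)%R by ring.
exact: sqr_ge0.
Qed.

Lemma integral_laplace_half (k : measurableTypeR R -> \bar R) :
  measurable_fun (`]0%R, +oo[%classic : set (measurableTypeR R)) k -> (forall t, 0 <= k t) ->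
  \int[lebesgue_measure]_(t in `]0%R, +oo[) (k t * (laplace_pdf t)%:E) =
  (2^-1)%:E * \int[lebesgue_measure]_(t in `]0%R, +oo[) (k t * (expR (- t))%:E).
Proof.
move=> mk k0; rewrite -ge0_integralZl//; last 2 first.
- apply: emeasurable_funM => //; apply/measurable_EFinP; apply: measurable_funTS.
  by apply: measurableT_comp => //; exact: measurable_expR.
- by move=> t _; rewrite mule_ge0// lee_fin expR_ge0.
apply: eq_integral => t; rewrite inE /= in_itv /= andbT => t0.
by rewrite muleCA -EFinM /laplace_pdf gtr0_norm// mulrC.
Qed.

(** The function [f] may have a corner at 0, where its one-sided derivatives
differ: [fh] and [gh] describe it and its derivative on the two closed half
lines. Centering [f] at [f 0] instead of its mean lets
[exponential_poincare] be applied to each half line. *)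
Lemma laplace_poincare (f : R -> R) (D : R -> \bar R) (B : R) (fh gh : bool -> R -> R) :
  measurable_fun [set: measurableTypeR R] f -> (forall t, (`|f t| <= B)%R) ->
  measurable_fun [set: measurableTypeR R] D -> (forall t, 0 <= D t) ->
  (forall (b : bool) (t : R), (0 <= t)%R -> is_derive t (1 : R)%R (fh b) (gh b t)) ->
  (forall (b : bool) (t : R), (0 <= t)%R -> {for t, continuous (gh b)}) ->
  (forall (b : bool) (t : R), (0 <= t)%R -> f ((-1) ^+ b * t)%R = fh b t) ->
  (forall (b : bool) (t : R), (0 < t)%R -> D ((-1) ^+ b * t)%R = (4 * gh b t ^+ 2)%:E) ->
  variance_of (@laplace_prob R) f <= \int[@laplace_prob R]_t D t.
Proof.
move=> mf fB mD D0 fg cg fE DE.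
apply: (le_trans (variance_of_le (f 0%R) (probability_setT _) mf fB)).
have mf2 : measurable_fun setT (fun t : measurableTypeR R => ((f t - f 0) ^+ 2)%:E : \bar R).
  by apply/measurable_EFinP; apply: measurable_funX; exact: measurable_funB.
have f20 t : 0 <= ((f t - f 0%R) ^+ 2)%:E :> \bar R by rewrite lee_fin sqr_ge0.
have mpdf : measurable_fun setT (fun t : measurableTypeR R => (laplace_pdf t)%:E : \bar R).
  by apply/measurable_EFinP; exact: measurable_laplace_pdf.
have pdf0 t : 0 <= (laplace_pdf t)%:E :> \bar R by rewrite lee_fin laplace_pdf_ge0.
rewrite !ge0_integral_laplace//.
rewrite !ge0_integral_lebesgue_split//; try exact: emeasurable_funM;
  try (by move=> t; rewrite mule_ge0).
have le_eq (x y : \bar R) : x = y -> x <= y by move=> ->.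
have half (b : bool) : \int[lebesgue_measure]_(t in `]0%R, +oo[)
    (((f ((-1) ^+ b * t) - f 0) ^+ 2)%:E * (laplace_pdf t)%:E) <=
  \int[lebesgue_measure]_(t in `]0%R, +oo[) (D ((-1) ^+ b * t)%R * (laplace_pdf t)%:E).
  have ms : measurable_fun setT (fun t : measurableTypeR R => ((-1) ^+ b * t)%R : measurableTypeR R).
    exact: measurable_funM.
  rewrite (integral_laplace_half (k := fun t => ((f ((-1) ^+ b * t) - f 0) ^+ 2)%:E))//; last first.
    by apply: measurable_funTS; exact: (measurableT_comp mf2 ms).
  rewrite (integral_laplace_half (k := fun t => D ((-1) ^+ b * t)%R))//; last first.
    by apply: measurable_funTS; exact: (measurableT_comp mD ms).
  rewrite lee_wpmul2l ?lee_fin//.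
  apply: le_trans (le_trans (exponential_poincare (fg b) (cg b)) _).
    apply: le_eq; apply: eq_integral => t; rewrite inE /= in_itv /= andbT => t0.
    by rewrite -EFinM fE ?ltW// -(fE b 0%R)// mulr0.
  apply: le_eq; apply: eq_integral => t; rewrite inE /= in_itv /= andbT => t0.
  by rewrite EFinM DE.
apply: leeD.
  by have := half false; under eq_integral do rewrite expr0 mul1r;
     under [X in _ <= X -> _]eq_integral do rewrite expr0 mul1r.
have := half true; under eq_integral do rewrite expr1 mulN1r.
under [X in _ <= X -> _]eq_integral do rewrite expr1 mulN1r.
under [X in _ -> X <= _]eq_integral do rewrite /laplace_pdf normrN.
by under [X in _ -> _ <= X]eq_integral do rewrite /laplace_pdf normrN.
Qed.

End laplace_poincare.

(** * The normalized function along a line parallel to an axis *)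

Section fibre.
Context {R : realType} (n : nat).
Variable G : 'rV[R]_n -> R.
Hypothesis dG : forall x, differentiable G x.
Hypothesis cG : continuous (grad G).

Definition dot k (u v : 'rV[R]_k) : R := \sum_(j < k) u 0 j * v 0 j.

Lemma derive_dot (p v : 'rV[R]_n) : 'D_v G p = dot v (grad G p).
Proof.
rewrite deriveE// [X in 'd G p X](row_sum_delta v) linear_sum; apply: eq_bigr => j _.
by rewrite linearZ mxE deriveE.
Qed.

Lemma is_derive_line (a v : 'rV[R]_n) (b : R) :
  is_derive b 1 (fun b => G (a + b *: v)) (dot v (grad G (a + b *: v))).
Proof.
have E : (fun h : R => h^-1 *: (((fun b => G (a + b *: v)) \o shift b) (h *: 1) - G (a + b *: v)))
  = (fun h : R => h^-1 *: ((G \o shift (a + b *: v)) (h *: v) - G (a + b *: v))).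
  apply/funext => h /=; congr (_ *: (G _ - _)).
  by rewrite -[h *: 1]/(h * 1) mulr1 scalerDl addrCA.
split.
  by rewrite /derivable E; exact: diff_derivable.
by rewrite /derive E -derive_dot.
Qed.

Lemma is_derive_inv_line (a v : 'rV[R]_n) (c t : R) : 0 < c -> 0 <= t ->
  is_derive t 1 (fun t => G (a + (t + c)^-1 *: v))
    (- (t + c) ^- 2 * dot v (grad G (a + (t + c)^-1 *: v))).
Proof.
move=> c0 t0; have tc0 : t + c != 0 by rewrite gt_eqF// ltr_wpDl.
have d1 : is_derive t 1 (fun t : R => (t + c)^-1) (- (t + c) ^- 2).
  have d0 : is_derive t 1 (fun t : R => t + c) 1.
    by apply: is_derive_eq; rewrite addr0.
  by apply: (is_derive_eq (@is_deriveV _ (fun t : R => t + c) t 1 1 tc0 d0)); rewrite /GRing.scale /= mulr1.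
apply: (is_derive_eq (@is_derive1_comp _ (fun b => G (a + b *: v))
  (fun t => (t + c)^-1) t _ _ (is_derive_line a v (t + c)^-1) d1)).
by rewrite mulrC.
Qed.

Lemma continuous_dot (v : 'rV[R]_n) : continuous (dot v).
Proof.
rewrite /dot; apply: continuous_big => [|i _ u]; first exact: add_continuous.
have cu : (fun w : 'rV[R]_n => w 0 i) w @[w --> u] --> u 0 i by exact: coord_continuous.
have := @cvgMl_tmp _ _ _ _ _ (v 0 i) _ cu; exact.
Qed.

Lemma continuous_inv_line (a v : 'rV[R]_n) (c t : R) : 0 < c -> 0 <= t ->
  {for t, continuous (fun t : R => - (t + c) ^- 2 * dot v (grad G (a + (t + c)^-1 *: v)))}.
Proof.
move=> c0 t0; have tc0 : t + c != 0 by rewrite gt_eqF// ltr_wpDl.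
have cb : (t + c)^-1 @[t --> t] --> (t + c)^-1.
  by apply: cvgV => //; apply: cvgD; [exact: cvg_id|exact: cvg_cst].
rewrite /prop_for /continuous_at.
rewrite -exprVn; under eq_fun do rewrite -exprVn.
apply: cvgM; first by apply: cvgN; apply: cvgM.
have cp : (a + (s + c)^-1 *: v) @[s --> t] --> a + (t + c)^-1 *: v.
  by apply: cvgD; [exact: cvg_cst|apply: cvgZr_tmp].
have cgr : grad G (a + (s + c)^-1 *: v) @[s --> t] --> grad G (a + (t + c)^-1 *: v).
  exact: (continuous_cvg _ (@cG (a + (t + c)^-1 *: v)) cp).
exact: (continuous_cvg _ (@continuous_dot v _) cgr).
Qed.

(** The square of the i-th partial derivative of G o N at [x], off the coordinate
hyperplanes. *)
Definition partial_sq (i : 'I_n) (x : borel_rV R n) : R :=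
  let z := l1proj x in let g := grad G z in
  ((l1norm (x : 'rV[R]_n))^-1 * (g 0 i - dot g z * Num.sg ((x : 'rV[R]_n) 0 i))) ^+ 2.

Lemma dot_lincomb (u v w : 'rV[R]_n) (k l : R) :
  dot u (k *: v + l *: w) = k * dot u v + l * dot u w.
Proof.
rewrite /dot !mulr_sumr -big_split /=; apply: eq_bigr => j _.
by rewrite !mxE; ring.
Qed.

Lemma dotC (u v : 'rV[R]_n) : dot u v = dot v u.
Proof. by apply: eq_bigr => j _; rewrite mulrC. Qed.

Lemma dot_delta (u : 'rV[R]_n) i : dot u (delta_mx 0 i) = u 0 i.
Proof.
rewrite /dot (bigD1 i)//= big1 ?addr0; first by rewrite mxE !eqxx mulr1.
by move=> j ji; rewrite mxE (negbTE ji) andbF mulr0.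
Qed.

Lemma l1norm_upd (x : 'rV[R]_n) i t :
  l1norm (upd x i t : 'rV[R]_n) = `|t| + l1norm (upd x i 0 : 'rV[R]_n).
Proof.
rewrite /l1norm (bigD1 i)//= [in RHS](bigD1 i)//= !mxE eqxx normr0 add0r.
by congr (_ + _); apply: eq_bigr => j ji; rewrite !mxE (negbTE ji).
Qed.

Lemma updE (x : 'rV[R]_n) i t : (upd x i t : 'rV[R]_n) = upd x i 0 + t *: delta_mx 0 i.
Proof.
apply/rowP => j; rewrite !mxE eqxx /=; case: (j == i); first by rewrite mulr1 add0r.
by rewrite mulr0 addr0.
Qed.

(** On each half of a line parallel to an axis, N x moves along a segment of fixed
direction, and the parameter on this segment is (t + c) ^-1 where c is the l1
norm of the other coordinates. Only directional derivatives of G are thus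
needed, and no chain rule in several variables. *)
Lemma l1proj_half_line (x : 'rV[R]_n) i (b : bool) (t : R) : 0 <= t ->
  0 < l1norm (upd x i 0 : 'rV[R]_n) ->
  (l1proj (upd x i ((-1) ^+ b * t)) : 'rV[R]_n) =
  (-1) ^+ b *: delta_mx 0 i + (t + l1norm (upd x i 0 : 'rV[R]_n))^-1 *:
    ((upd x i 0 : 'rV[R]_n) - ((-1) ^+ b * l1norm (upd x i 0 : 'rV[R]_n)) *: delta_mx 0 i).
Proof.
move=> t0 c0; rewrite /l1proj l1norm_upd normrMsign ger0_norm//.
rewrite (updE x i ((-1) ^+ b * t)).
set c := l1norm _ in c0 *; set w : 'rV[R]_n := upd x i 0.
have tc0 : t + c != 0 by rewrite gt_eqF// ltr_wpDl.
move: (delta_mx 0 i : 'rV[R]_n) w => E w.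
by apply/rowP => j; rewrite !mxE; field.
Qed.

Lemma partial_sq_half_line (x : 'rV[R]_n) i (b : bool) (t : R) : 0 < t ->
  0 < l1norm (upd x i 0 : 'rV[R]_n) ->
  let c := l1norm (upd x i 0 : 'rV[R]_n) in
  let v := (upd x i 0 : 'rV[R]_n) - ((-1) ^+ b * c) *: delta_mx 0 i in
  partial_sq i (upd x i ((-1) ^+ b * t)) =
  (- (t + c) ^- 2 * dot v (grad G ((-1) ^+ b *: delta_mx 0 i + (t + c)^-1 *: v))) ^+ 2.
Proof.
move=> t0 c0 c v; rewrite /partial_sq l1proj_half_line ?ltW// -/c -/v.
set p := _ + _ *: v; set g := grad G p.
rewrite l1norm_upd normrMsign gtr0_norm// -/c.
have -> : (upd x i ((-1) ^+ b * t) : 'rV[R]_n) 0 i = (-1) ^+ b * t.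
  by rewrite mxE eqxx.
have tc0 : t + c != 0 by rewrite gt_eqF// ltr_wpDl// ltW.
have -> : Num.sg ((-1) ^+ b * t) = (-1) ^+ b.
  by rewrite sgrM (gtr0_sg t0) mulr1 sgrX sgrN1.
rewrite {1}/p dot_lincomb dot_delta (dotC v).
have s2 : ((-1) ^+ b) ^+ 2 = 1 :> R by rewrite sqrr_sign.
have -> : (t + c)^-1 * (g 0 i - ((-1) ^+ b * g 0 i + (t + c)^-1 * dot g v) * (-1) ^+ b) =
  (t + c)^-1 * (g 0 i * (1 - ((-1) ^+ b) ^+ 2)) - (-1) ^+ b * ((t + c) ^- 2 * dot g v).
  by field.
rewrite s2 subrr !mulr0 sub0r sqrrN exprMn s2 mul1r.
by rewrite mulNr sqrrN.
Qed.

Lemma measurable_sgr : measurable_fun [set: measurableTypeR R] (@Num.sg R).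
Proof.
have -> : (@Num.sg R) = (fun x => \1_[set y | 0 < y] x - \1_[set y | y < 0] x).
  apply/funext => x; rewrite !indicE; case: sgrP => [->|x0|x0].
  - by rewrite !memNset ?subr0//= ltxx.
  - by rewrite mem_set// memNset ?subr0//=; apply/negP; rewrite -leNgt ltW.
  - by rewrite memNset ?mem_set ?sub0r//=; apply/negP; rewrite -leNgt ltW.
by apply: measurable_funB; apply: measurable_indic; exact: measurable_ltr_set.
Qed.

Lemma measurable_G : measurable_fun setT (G : borel_rV R n -> R).
Proof. by apply: continuous_measurable_rV => x; exact: differentiable_continuous. Qed.

Lemma measurable_gradG j :
  measurable_fun setT (fun x : borel_rV R n => grad G (x : 'rV[R]_n) 0 j).
Proof.
apply: (@continuous_measurable_rV _ _ (fun x => grad G x 0 j)) => x.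
exact: (continuous_cvg _ (@coord_continuous _ _ _ 0 j (grad G x)) (@cG x)).
Qed.

Lemma measurable_partial_sq i : measurable_fun setT (partial_sq i).
Proof.
have mp := @measurable_l1proj R n.
have mg j : measurable_fun setT (fun x : borel_rV R n => grad G (l1proj x) 0 j).
  exact: (measurableT_comp (measurable_gradG j) mp).
apply: measurable_funX; apply: measurable_funM.
  by apply: measurable_inv_fun; exact: measurable_l1norm.
apply: measurable_funB => //; apply: measurable_funM; last first.
  exact: (measurableT_comp measurable_sgr (@measurable_coord R n i)).
apply: measurable_sum => j; apply: measurable_funM => //.
exact: (measurableT_comp (@measurable_coord R n j) mp).
Qed.

Lemma measurable_upd (x : 'rV[R]_n) i :
  measurable_fun [set: measurableTypeR R] (fun t => upd x i t).
Proof.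
apply: measurable_fun_rV => j; under eq_fun do rewrite mxE.
by case: (j == i); [exact: measurable_id|exact: measurable_cst].
Qed.

Lemma l1norm_upd_gt0 (x : borel_rV R n) i : (1 < n)%N -> off_hyperplanes x ->
  0 < l1norm (upd (x : 'rV[R]_n) i 0 : 'rV[R]_n).
Proof.
move=> n1 x0.
have [j ji] : exists j : 'I_n, j != i.
  case: n n1 i {x x0} => [//|[//|k]] _ i.
  exists (lift i ord0); by rewrite eq_sym neq_lift.
rewrite /l1norm (bigD1 j)//= ltr_pwDl ?sumr_ge0//.
by rewrite mxE (negbTE ji) normr_gt0.
Qed.

Lemma l1proj_coord (x : borel_rV R n) i : `|(l1proj x : 'rV[R]_n) 0 i| <= 1.
Proof.
rewrite mxE normrM ger0_norm ?invr_ge0 ?l1norm_ge0//.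
have [->|x0] := eqVneq (l1norm (x : 'rV[R]_n)) 0; first by rewrite invr0 mul0r.
rewrite mulrC ler_pdivrMr ?mul1r; last by rewrite lt0r x0 l1norm_ge0.
by rewrite /l1norm (bigD1 i)//= lerDl sumr_ge0.
Qed.

(** The points N x stay in a compact cube. *)
Lemma bounded_G_l1proj : exists B, forall x, `|G (l1proj x)| <= B.
Proof.
pose K : set 'rV[R]_n := [set v | forall i, v ord0 i \in `[(-1), 1]].
have co : compact K.
  exact: (@rV_compact R n (fun=> `[(-1), 1]%classic) (fun=> @segment_compact R _ _)).
have : compact (G @` K).
  apply: continuous_compact co; apply: continuous_subspaceT => x.
  exact: differentiable_continuous.
move=> /compact_bounded[M [_ /(_ (M + 1))]].
rewrite ltrDl ltr01 => /(_ isT) MB; exists (M + 1) => x.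
apply: MB; exists (l1proj x : 'rV[R]_n) => // i /=.
by rewrite in_itv /= -ler_norml l1proj_coord.
Qed.

(** A line off the coordinate hyperplanes, in dimension at least 2, stays away from
the origin, so that the normalized function is C^1 on each of its halves. *)
Theorem fibre_poincare (x : borel_rV R n) i : (1 < n)%N -> off_hyperplanes x ->
  (variance_of (@laplace_prob R) (fun t => G (l1proj (upd (x : 'rV[R]_n) i t))) <=
   \int[@laplace_prob R]_t (4 * partial_sq i (upd (x : 'rV[R]_n) i t))%:E)%E.
Proof.
move=> n1 x0; have c0 := l1norm_upd_gt0 i n1 x0.
set c := l1norm _ in c0.
have [B GB] := bounded_G_l1proj.
pose a (b : bool) : 'rV[R]_n := (-1) ^+ b *: delta_mx 0 i.
pose v (b : bool) : 'rV[R]_n :=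
  (upd (x : 'rV[R]_n) i 0 : 'rV[R]_n) - ((-1) ^+ b * c) *: delta_mx 0 i.
apply: (@laplace_poincare _ _ _ B (fun b t => G (a b + (t + c)^-1 *: v b))
  (fun b t => - (t + c) ^- 2 * dot (v b) (grad G (a b + (t + c)^-1 *: v b)))).
- apply: (measurableT_comp measurable_G).
  exact: (measurableT_comp (@measurable_l1proj R n) (measurable_upd _ _)).
- by move=> t; exact: GB.
- apply/measurable_EFinP; apply: measurable_funM => //.
  exact: (measurableT_comp (measurable_partial_sq i) (measurable_upd _ _)).
- by move=> t; rewrite lee_fin mulr_ge0// sqr_ge0.
- by move=> b t t0; exact: is_derive_inv_line.
- by move=> b t t0; exact: continuous_inv_line.
- by move=> b t t0; rewrite l1proj_half_line.
- by move=> b t t0; rewrite partial_sq_half_line.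
Qed.

End fibre.

(** * The variance inequality for functions of class C^1 *)

Section core.
Context {R : realType}.
Local Notation lap n := (mpow (@laplace_prob R) n).

Lemma dot_ge0 n (u : 'rV[R]_n) : 0 <= dot u u.
Proof. by apply: sumr_ge0 => i _; rewrite -expr2 sqr_ge0. Qed.

Lemma dot_cauchy_schwarz n (u v : 'rV[R]_n) : dot u v ^+ 2 <= dot u u * dot v v.
Proof.
have [v0|v0] := eqVneq (dot v v) 0.
  have vi i : v 0 i = 0.
    apply/eqP; rewrite -sqrf_eq0 expr2.
    have := v0; rewrite /dot => /eqP; rewrite psumr_eq0; last first.
      by move=> j _; rewrite -expr2 sqr_ge0.
    by move=> /allP/(_ i); rewrite mem_index_enum => /(_ isT).
  by rewrite v0 mulr0 /dot big1 ?expr0n// => i _; rewrite vi mulr0.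
have vp : 0 < dot v v by rewrite lt0r v0 dot_ge0.
pose k := dot u v / dot v v.
have := dot_ge0 (1 *: u + (- k) *: v).
rewrite dot_lincomb (dotC _ u) (dotC _ v) !dot_lincomb (dotC v u) mul1r.
have -> : 1 * dot u u + - k * dot u v + - k * (1 * dot u v + - k * dot v v)
  = dot u u - dot u v ^+ 2 / dot v v by rewrite /k; field.
by rewrite subr_ge0 ler_pdivrMr.
Qed.

(** The linear map of g to g - <g, z> s is the projection along s onto the
orthogonal of z. A projection has the same norm as its complement, here the rank
one map of g to <g, z> s, of norm |s|_2 |z|_2. The proof applies the
Cauchy-Schwarz inequality to the components of g and z orthogonal to s, scaled
by |s|_2 ^ 2 in the case of z. *)
Lemma oblique_projection n (g z s : 'rV[R]_n) : dot s z = 1 ->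
  \sum_(i < n) (g 0 i - dot g z * s 0 i) ^+ 2 <= dot s s * dot z z * dot g g.
Proof.
move=> sz1.
set a := dot g z; pose c := dot g s; pose k := dot s s; pose p := dot z z; pose q := dot g g.
have k0 : 0 < k.
  rewrite lt0r dot_ge0 andbT; apply/eqP => k0.
  have := dot_cauchy_schwarz s z; rewrite sz1 -/k k0 mul0r expr1n; lra.
have -> : \sum_(i < n) (g 0 i - a * s 0 i) ^+ 2 = q - 2 * a * c + k * a ^+ 2.
  rewrite /q /c /k /dot mulr_sumr mulr_suml -sumrB -big_split /=.
  by apply: eq_bigr => i _; ring.
have := dot_cauchy_schwarz (1 *: g + (- (c / k)) *: s) (k *: z + (-1) *: s).
rewrite !dot_lincomb !(dotC (_ + _)) !dot_lincomb.
rewrite (dotC z g) (dotC z s) (dotC s g) sz1 -/a -/c -/k -/p -/q => h.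
have {}h : (k * a - c) ^+ 2 <= (k * q - c ^+ 2) * (k * p - 1).
  move: h; congr (_ <= _).
    by congr (_ ^+ 2); field; rewrite gt_eqF.
  by field; rewrite gt_eqF.
have kq : k * q - c ^+ 2 <= k * q by rewrite gerBl sqr_ge0.
have kp0 : 0 <= k * p by rewrite mulr_ge0 ?dot_ge0.
rewrite -(ler_pM2l k0).
have -> : k * (q - 2 * a * c + k * a ^+ 2) = (k * q - c ^+ 2) + (k * a - c) ^+ 2 by ring.
apply: (@le_trans _ _ ((k * q - c ^+ 2) * (k * p))).
  by move: h; rewrite mulrBr mulr1; lra.
have -> : k * (k * p * q) = (k * q) * (k * p) by ring.
exact: ler_wpM2r.
Qed.

Lemma l2norm_sq n (u : 'rV[R]_n) : l2norm u ^+ 2 = dot u u.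
Proof.
rewrite /l2norm sqr_sqrtr; first by apply: eq_bigr => i _; rewrite expr2.
by apply: sumr_ge0 => i _; exact: sqr_ge0.
Qed.

Lemma measurable_dot d (T : measurableType d) n (f g : T -> borel_rV R n) :
  measurable_fun setT f -> measurable_fun setT g ->
  measurable_fun setT (fun x => dot (f x : 'rV[R]_n) (g x)).
Proof.
move=> mf mg; apply: measurable_sum => i; apply: measurable_funM.
  exact: (measurableT_comp (@measurable_coord R n i) mf).
exact: (measurableT_comp (@measurable_coord R n i) mg).
Qed.

(** [oblique_projection] for the vector s of signs of x; it satisfies <s, z> = 1
when z = N x, and |s|_2 ^ 2 <= n. *)
Lemma sum_partial_sq n (G : 'rV[R]_n -> R) (x : borel_rV R n) :
  \sum_(i < n) partial_sq G i x <=
  (l1norm (x : 'rV[R]_n))^-1 ^+ 2 *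
  (n%:R * dot (l1proj x : 'rV[R]_n) (l1proj x) * dot (grad G (l1proj x)) (grad G (l1proj x))).
Proof.
rewrite /partial_sq; set z : 'rV[R]_n := l1proj x; set g := grad G z; set r := l1norm _.
under eq_bigr do rewrite exprMn.
rewrite -mulr_sumr; have [->|r0] := eqVneq r 0; first by rewrite invr0 expr0n !mul0r.
rewrite ler_wpM2l ?sqr_ge0//.
pose s : 'rV[R]_n := \row_i Num.sg ((x : 'rV[R]_n) 0 i).
have -> : \sum_(i < n) (g 0 i - dot g z * Num.sg ((x : 'rV[R]_n) 0 i)) ^+ 2 =
   \sum_(i < n) (g 0 i - dot g z * s 0 i) ^+ 2.
  by apply: eq_bigr => i _; rewrite [s 0 i]mxE.
apply: (le_trans (oblique_projection g _)).
  rewrite /dot; transitivity (\sum_(i < n) r^-1 * `|(x : 'rV[R]_n) 0 i|).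
    by apply: eq_bigr => i _; rewrite !mxE mulrCA normrEsg.
  by rewrite -mulr_sumr mulVf.
rewrite ler_wpM2r ?dot_ge0// ler_wpM2r ?dot_ge0//.
rewrite -[X in _ <= X%:R](card_ord n) -sum1_card natr_sum ler_sum// => i _.
by rewrite mxE -expr2 sqr_sg; case: (_ == _).
Qed.

(** The mean of |X|_1 ^ -2 for a Laplace vector X in dimension [n.+1]. *)
Lemma fact_ratio n : (2 <= n)%N ->
  n.-2`!%:R / n`!%:R = (n%:R * (n%:R - 1))^-1 :> R.
Proof.
case: n => [//|[//|k]] _; rewrite !factS !natrM /=.
have k1 : k.+2%:R - 1 = k.+1%:R :> R by rewrite -natr1 addrK.
have f0 : k`!%:R != 0 :> R by rewrite pnatr_eq0 -lt0n fact_gt0.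
have : k.+1%:R != 0 :> R by rewrite pnatr_eq0.
have : k.+2%:R != 0 :> R by rewrite pnatr_eq0.
rewrite k1; move: (k.+2%:R) (k.+1%:R) (k`!%:R) f0 => a b c c0 a0 b0.
by field; rewrite a0 b0 c0.
Qed.

Lemma exprn_inv_sq n (r : R) : (2 <= n)%N -> 0 < r -> r ^+ n * r^-1 ^+ 2 = r ^+ n.-2.
Proof.
by case: n => [//|[//|k]] _ r0; rewrite !exprS; field; rewrite gt_eqF.
Qed.

(** Tensorization, the Poincare inequality on the lines and [sum_partial_sq] bound
the variance by the mean of |X|_1 ^ -2 times a function of N X; the two factors
are independent. *)
Theorem variance_C1 n (G : 'rV[R]_n.+1 -> R) : (2 <= n)%N ->
  (forall x, differentiable G x) -> continuous (grad G) ->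
  (variance_of (lap n.+1) (G \o @l1proj R n.+1) <=
   (4 / (n%:R * (n%:R - 1)))%:E * \int[lap n.+1]_x
     (n.+1%:R * dot (l1proj x : 'rV[R]_n.+1) (l1proj x) *
      dot (grad G (l1proj x)) (grad G (l1proj x)))%:E)%E.
Proof.
move=> n2 dG cG.
have [B GB] := bounded_G_l1proj dG.
have mF : measurable_fun setT (G \o @l1proj R n.+1 : borel_rV R n.+1 -> R).
  exact: (measurableT_comp (measurable_G dG) (@measurable_l1proj R n.+1)).
have m0 : (@laplace_prob R [set 0%R] = 0)%E.
  by rewrite /laplace_prob integral_set1.
have mps i : measurable_fun setT (fun x : borel_rV R n.+1 => (4 * partial_sq G i x)%:E : \bar R).
  by apply/measurable_EFinP; apply: measurable_funM => //; exact: measurable_partial_sq.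
have ps0 i (x : borel_rV R n.+1) : (0 <= (4 * partial_sq G i x)%:E :> \bar R)%E.
  by rewrite lee_fin mulr_ge0// sqr_ge0.
apply: (le_trans (variance_tensorization m0 (B := B)
  (D := fun i x => (4 * partial_sq G i x)%:E) mF GB mps ps0 _)).
  by move=> i x x0; apply: fibre_poincare => //; exact: ltnW.
rewrite -ge0_integral_sum//.
pose phi (z : borel_rV R n.+1) : \bar R := (n.+1%:R * dot (z : 'rV[R]_n.+1) z *
      dot (grad G z) (grad G z))%:E.
have mid : measurable_fun setT (fun z : borel_rV R n.+1 => z) by exact: measurable_id.
have mgrad : measurable_fun setT (fun z : borel_rV R n.+1 => grad G z : borel_rV R n.+1).
  by apply: measurable_fun_rV => i; exact: measurable_gradG.
have mphi : measurable_fun setT phi.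
  apply/measurable_EFinP; apply: measurable_funM; last exact: measurable_dot.
  by apply: measurable_funM => //; exact: measurable_dot.
have phi0 z : (0 <= phi z)%E by rewrite lee_fin !mulr_ge0// dot_ge0.
have mphil : measurable_fun setT (fun x : borel_rV R n.+1 => phi (l1proj x)).
  exact: (measurableT_comp mphi (@measurable_l1proj R n.+1)).
pose phi4 (z : borel_rV R n.+1) : \bar R := ((4 : R)%:E * phi z)%E.
have mphi4 : measurable_fun setT phi4 by exact: emeasurable_funM.
have phi40 z : (0 <= phi4 z)%E by rewrite mule_ge0// lee_fin.
pose w (r : measurableTypeR R) : R := r^-1 ^+ 2.
have mw : measurable_fun setT w by apply: measurable_funX; exact: measurable_inv_fun.
have w0 r : 0 <= w r by exact: sqr_ge0.
have wk (r : R) : 0 < r -> r ^+ n * w r = r ^+ n.-2.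
  by move=> r0; exact: exprn_inv_sq.
apply: (@le_trans _ _ (\int[lap n.+1]_x
    ((w (l1norm (x : 'rV[R]_n.+1)))%:E * phi4 (l1proj x)))%E).
  apply: ge0_le_integral => //.
  - by move=> x _; apply: sume_ge0.
  - exact: emeasurable_sum.
  - apply: emeasurable_funM; last exact: (measurableT_comp mphi4 (@measurable_l1proj R n.+1)).
    by apply/measurable_EFinP; exact: (measurableT_comp mw (@measurable_l1norm R n.+1)).
  - move=> x _; rewrite sumEFin -!EFinM lee_fin -mulr_sumr mulrCA ler_wpM2l//.
    exact: sum_partial_sq.
rewrite (integral_l1proj_weight mw w0 wk)//.
rewrite ge0_integralZl// muleA -EFinM.
rewrite le_eqVlt; apply/orP; left; apply/eqP; congr (_%:E * _)%E.
by rewrite fact_ratio// mulrC.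
Qed.

End core.

(** * Second moment of the uniform law, gradient of a Lipschitz function *)

Section moments.
Context {R : realType}.
Local Notation lap n := (mpow (@laplace_prob R) n).

Lemma laplace_second_moment : (\int[@laplace_prob R]_t (t ^+ 2)%:E = (2 : R)%:E)%E.
Proof.
have m2 : measurable_fun setT (fun t : measurableTypeR R => (t ^+ 2)%:E : \bar R).
  by apply/measurable_EFinP; exact: measurable_funX.
have p2 (t : R) : (0 <= (t ^+ 2)%:E)%E by rewrite lee_fin sqr_ge0.
have mpdf : measurable_fun setT (fun t : measurableTypeR R => (laplace_pdf t)%:E : \bar R).
  by apply/measurable_EFinP; exact: measurable_laplace_pdf.
rewrite ge0_integral_laplace// ge0_integral_lebesgue_split; last 2 first.
- exact: emeasurable_funM.
- by move=> t; rewrite mule_ge0// lee_fin laplace_pdf_ge0.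
have -> : (\int[lebesgue_measure]_(t in `]0%R, +oo[) (((- t) ^+ 2)%:E * (laplace_pdf (- t))%:E) =
  \int[lebesgue_measure]_(t in `]0%R, +oo[) (((t : R) ^+ 2)%:E * (laplace_pdf t)%:E))%E.
  by apply: eq_integral => t _; rewrite sqrrN /laplace_pdf normrN.
rewrite integral_laplace_half//; last exact: measurable_funTS.
under eq_integral do rewrite -EFinM.
by rewrite gamma_integral -EFinM -EFinD !factS fact0; congr EFin; lra.
Qed.

Lemma laplace_rV_second_moment n :
  (\int[lap n]_x (dot (x : 'rV[R]_n) x)%:E = (2 * n%:R : R)%:E)%E.
Proof.
have mdot k : measurable_fun setT (fun x : borel_rV R k => (dot (x : 'rV[R]_k) x)%:E : \bar R).
  by apply/measurable_EFinP; exact: measurable_dot.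
have dot0 k (x : borel_rV R k) : (0 <= (dot (x : 'rV[R]_k) x)%:E)%E.
  by rewrite lee_fin dot_ge0.
elim: n => [|n IH].
  by rewrite ge0_integral_mpow0// /dot big_ord0 mulr0.
rewrite ge0_integral_mpowS//.
transitivity (\int[@laplace_prob R]_t ((t ^+ 2)%:E + (2 * n%:R : R)%:E))%E.
  apply: eq_integral => t _.
  transitivity (\int[lap n]_u ((t ^+ 2)%:E + (dot (u : 'rV[R]_n) u)%:E))%E.
    apply: eq_integral => u _; rewrite -EFinD /dot big_ord_recl consv0; congr (_%:E).
    by rewrite expr2; congr (_ + _); apply: eq_bigr => i _; rewrite consvS.
  rewrite ge0_integralD//; last by move=> u _; rewrite lee_fin sqr_ge0.
  rewrite IH; congr (_ + _)%E.
  by rewrite integral_cst// -[RHS]mule1; congr (_ * _)%E; exact: mpow1.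
rewrite ge0_integralD//; last 2 first.
- by move=> t _; rewrite lee_fin sqr_ge0.
- by apply/measurable_EFinP; exact: measurable_funX.
rewrite laplace_second_moment integral_cst//.
transitivity ((2 : R)%:E + (2 * n%:R : R)%:E * 1)%E.
  by congr (_ + _ * _)%E; exact: probability_setT.
by rewrite mule1 -EFinD; congr EFin; rewrite -natr1; ring.
Qed.

(** By independence E |X|_2 ^ 2 = E |X|_1 ^ 2 E |N X|_2 ^ 2, where the left-hand
side is 2 n.+1 and E |X|_1 ^ 2 = (n + 1) (n + 2). *)
Lemma l1proj_second_moment n :
  (\int[lap n.+1]_x (dot (l1proj x : 'rV[R]_n.+1) (l1proj x))%:E =
   (2 / (n.+1%:R + 1) : R)%:E)%E.
Proof.
have mdot k : measurable_fun setT (fun x : borel_rV R k => (dot (x : 'rV[R]_k) x)%:E : \bar R).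
  by apply/measurable_EFinP; exact: measurable_dot.
have dot0 k (x : borel_rV R k) : (0 <= (dot (x : 'rV[R]_k) x)%:E)%E.
  by rewrite lee_fin dot_ge0.
have msq : measurable_fun setT (fun r : measurableTypeR R => r ^+ 2) by exact: measurable_funX.
have wk (r : R) : 0 < r -> r ^+ n * r ^+ 2 = r ^+ n.+2 by move=> _; rewrite -exprD addn2.
have := integral_l1proj_weight msq (fun r => sqr_ge0 r) wk (mdot n.+1) (dot0 n.+1).
have -> : (\int[lap n.+1]_x ((l1norm (x : 'rV[R]_n.+1) ^+ 2)%:E *
    (dot (l1proj x : 'rV[R]_n.+1) (l1proj x))%:E) = (2 * n.+1%:R : R)%:E)%E.
  rewrite -laplace_rV_second_moment; apply: eq_integral => x _.
  rewrite -EFinM /l1proj; congr EFin.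
  have [r0|r0] := eqVneq (l1norm (x : 'rV[R]_n.+1)) 0.
    rewrite r0 expr0n mul0r /dot big1// => i _.
    move: r0 => /eqP; rewrite /l1norm psumr_eq0// => /allP/(_ i).
    by rewrite mem_index_enum normr_eq0 => /(_ isT)/eqP ->; rewrite mul0r.
  rewrite /dot mulr_sumr; apply: eq_bigr => i _; rewrite !mxE; field.
  exact: r0.
set I := (\int[_]_x _)%E => E.
have f0 : n`!%:R != 0 :> R by rewrite pnatr_eq0 -lt0n fact_gt0.
have fE : (n.+2)`!%:R / n`!%:R = (n.+1%:R + 1) * n.+1%:R :> R.
  rewrite !factS !natrM -[n.+2%:R]natr1.
  by rewrite mulrA mulfK.
move: E; rewrite fE; case: I => [i| |].
- rewrite -EFinM => -[] E; congr EFin.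
  have n1 : n.+1%:R != 0 :> R by rewrite pnatr_eq0.
  have n2 : n.+1%:R + 1 != 0 :> R by rewrite natr1 pnatr_eq0.
  apply: (mulfI n1); apply: (mulfI n2); rewrite mulrA -E.
  by rewrite [RHS]mulrCA [(_ + 1) * (2 / _)]mulrCA divff// mulr1 mulrC.
- by rewrite gt0_muley// lte_fin mulr_gt0// natr1 ltr0n.
- by rewrite gt0_muleNy// lte_fin mulr_gt0// natr1 ltr0n.
Qed.

Lemma l2normZ n (a : R) (u : 'rV[R]_n) : l2norm (a *: u) = `|a| * l2norm u.
Proof.
rewrite /l2norm -sqrtr_sqr -sqrtrM ?sqr_ge0// mulr_sumr.
by congr Num.sqrt; apply: eq_bigr => i _; rewrite mxE exprMn.
Qed.

(** The derivative of G in the direction of its gradient g is |g|_2 ^ 2, and at most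
L |g|_2. *)
Lemma grad_lipschitz n (G : 'rV[R]_n -> R) L x : l2_lipschitz L G ->
  (forall x, differentiable G x) -> dot (grad G x) (grad G x) <= L ^+ 2.
Proof.
move=> GL dG; set g := grad G x.
have [->|g0] := eqVneq (dot g g) 0; first exact: sqr_ge0.
have gp : 0 < l2norm g.
  rewrite lt0r sqrtr_ge0 andbT; apply: contra_neq g0 => g0.
  by rewrite -l2norm_sq g0 expr0n.
have H : dot g g <= L * l2norm g.
  rewrite -(derive_dot dG).
  have dv : derivable G x g by exact: diff_derivable.
  rewrite /derive; apply: limr_le; first exact: dv.
  near=> h; rewrite /= /GRing.scale /=.
  have h0 : h != 0 by near: h; exact: nbhs_dnbhs_neq.
  apply: (le_trans (ler_norm _)); rewrite normrM normfV ler_pdivrMl ?normr_gt0//.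
  by rewrite (le_trans (GL _ _))// addrK l2normZ mulrCA.
rewrite -l2norm_sq expr2 in H *.
have {}H : l2norm g <= L by rewrite -(ler_pM2r gp).
by rewrite expr2 ler_pM// ltW.
Unshelve. all: by end_near.
Qed.

End moments.

(** * Averages over the unit interval *)

Section unit_mean.
Context {R : realType}.
Local Notation mu := (@lebesgue_measure R).
Implicit Types u v : R -> R.

Definition unit_mean (u : R -> R) : R := \int[mu]_(s in `[0, 1]) u s.

Let itg u : continuous u -> mu.-integrable `[0, 1] (EFin \o u).
Proof.
move=> cu; apply: (@continuous_compact_integrable R u); first exact: segment_compact.
exact: continuous_subspaceT.
Qed.

Lemma unit_mean_cst c : unit_mean (fun=> c) = c.
Proof.
rewrite /unit_mean Rintegral_cst//= lebesgue_measure_itv/= lte_fin ltr01.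
by rewrite -EFinD/= subr0 mulr1.
Qed.

Lemma unit_meanB u v : continuous u -> continuous v ->
  unit_mean (fun s => u s - v s) = unit_mean u - unit_mean v.
Proof. by move=> cu cv; apply: RintegralB => //; exact: itg. Qed.

Lemma unit_meanZ a u : continuous u -> unit_mean (fun s => a * u s) = a * unit_mean u.
Proof. by move=> cu; apply: RintegralZl => //; exact: itg. Qed.

Lemma unit_mean_bound B u : continuous u -> (forall s, 0 <= s <= 1 -> `|u s| <= B) ->
  `|unit_mean u| <= B.
Proof.
move=> cu uB; apply: (le_trans (le_normr_Rintegral _ (itg cu))) => //.
rewrite -[leRHS]unit_mean_cst; apply: le_Rintegral => //.
- by apply: itg => s; apply: cvg_norm; exact: cu.
- by apply: itg; exact: cst_continuous.
Qed.

(** On a bounded interval containing the points of interest, so that the primitive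
can be an integral from its left end. *)
Lemma primitive_continuous u (a b : R) : a < b -> continuous u ->
  exists U, forall x, a < x < b -> is_derive x 1 U (u x).
Proof.
move=> ab cu; exists (fun x => \int[mu]_(t in `[a, x]) u t) => x /andP[ax xb].
have iu : mu.-integrable `[a, b] (EFin \o u).
  apply: (@continuous_compact_integrable R u); first exact: segment_compact.
  exact: continuous_subspaceT.
have [D E] := continuous_FTC1_closed xb iu ax (cu x).
apply: DeriveDef; first exact: D.
by rewrite -derive1E; exact: E.
Qed.

Lemma unit_mean_primitive u U (t e : R) : 0 < e -> continuous u ->
  (forall x, t <= x <= t + e -> is_derive x 1 U (u x)) ->
  unit_mean (fun s => u (t + e * s)) = (U (t + e) - U t) / e.
Proof.
move=> e0 cu dU.
have d (s : R) : 0 <= s <= 1 -> is_derive s 1 (fun s => U (t + e * s) / e) (u (t + e * s)).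
  move=> /andP[s0 s1].
  have dl : is_derive s 1 (fun s : R => t + e * s) e.
    by apply: is_derive_eq; rewrite add0r /GRing.scale /= mulr1 mul1r.
  have dU' : is_derive (t + e * s) 1 U (u (t + e * s)).
    by apply: dU; have := ler_piMr (ltW e0) s1; have := mulr_ge0 (ltW e0) s0; lra.
  have dc := @is_derive1_comp _ U (fun s : R => t + e * s) s _ _ dU' dl.
  have -> : (fun s => U (t + e * s) / e) = (e^-1 \*: (U \o (fun s : R => t + e * s)))%R.
    by apply/funext => z /=; rewrite mulrC.
  apply: (is_derive_eq (@is_deriveZ _ _ _ _ e^-1 _ _ _ dc)).
  by rewrite /GRing.scale /= mulrCA mulVf ?mulr1// gt_eqF.
have cl : continuous (fun s => u (t + e * s)).
  move=> s; apply: (continuous_cvg _ (@cu _)); apply: cvgD; first exact: cvg_cst.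
  by apply: cvgMl_tmp.
rewrite /unit_mean /Rintegral (@continuous_FTC2 _ _ (fun s => U (t + e * s) / e))//.
- by rewrite -EFinB/= mulr1 mulr0 addr0 mulrBl.
- exact: continuous_subspaceT.
- have c (s : R) : 0 <= s <= 1 -> {for s, continuous (fun s => U (t + e * s) / e)}.
    by move=> /d ds; apply: differentiable_continuous; apply/derivable1_diffP.
  split.
  + move=> s; rewrite in_itv/= => /andP[s0 s1].
    by have [] := d s; rewrite ?ltW.
  + by apply: cvg_at_right_filter; apply: c; rewrite lexx ler01.
  + by apply: cvg_at_left_filter; apply: c; rewrite lexx ler01.
- move=> s; rewrite in_itv/= => /andP[s0 s1].
  by rewrite derive1E; have [] := d s; rewrite ?ltW.
Qed.

(** With a primitive U of u, the average of u over [h, h + e] is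
(U (h + e) - U h) / e. By the mean value theorem its increment from h = 0 is
h (u (c + e) - u c) / e for some c with |c| <= |h|, and this quotient differs
from (u e - u 0) / e by at most 2 L |c| / e. *)
Lemma unit_mean_shift u (L e h : R) : 0 < e -> continuous u ->
  (forall x y, `|u x - u y| <= L * `|x - y|) ->
  `|unit_mean (fun s => u (h + e * s)) - unit_mean (fun s => u (e * s)) -
    h * ((u e - u 0) / e)| <= (2 * L / e) * h ^+ 2.
Proof.
move=> e0 cu uL.
have L0 : 0 <= L.
  by have := uL 1 0; rewrite subr0 normr1 mulr1; apply: le_trans.
(* an open interval containing the two segments and all the c below *)
pose a := - `|h| - 1; pose b := `|h| + e + 1.
have nh : - `|h| <= h <= `|h| by rewrite -ler_norml.
have ab : a < b by rewrite /a /b; have := normr_ge0 h; lra.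
have [U dU] := primitive_continuous ab cu.
have dUx (x : R) : - `|h| <= x <= `|h| + e -> is_derive x 1 U (u x).
  by move=> hx; apply: dU; rewrite /a /b; lra.
have -> : unit_mean (fun s => u (h + e * s)) = (U (h + e) - U h) / e.
  by apply: unit_mean_primitive => // x hx; apply: dUx; lra.
have -> : unit_mean (fun s => u (e * s)) = (U e - U 0) / e.
  under eq_fun do rewrite -[_ * _]add0r.
  rewrite -[in RHS](add0r e) [in X in _ / X]add0r.
  by apply: unit_mean_primitive => // x hx; apply: dUx; have := normr_ge0 h; lra.
pose W x := U (x + e) - U x.
have dW (x : R) : - `|h| <= x <= `|h| -> is_derive x 1 W (u (x + e) - u x).
  move=> hx.
  have d1 : is_derive x 1 (fun x : R => x + e) 1 by apply: is_derive_eq; rewrite addr0.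
  have d2 : is_derive x 1 (fun x => U (x + e)) (u (x + e)).
    have dU' : is_derive (x + e) 1 U (u (x + e)) by apply: dUx; lra.
    apply: (is_derive_eq (@is_derive1_comp _ U (fun x : R => x + e) x _ _ dU' d1)).
    by rewrite mulr1.
  have d3 : is_derive x 1 U (u x) by apply: dUx; lra.
  exact: is_deriveB.
have [c hc E] : exists2 c, `|c| <= `|h| & W h - W 0 = (u (c + e) - u c) * h.
  have [h0|h0|->] := ltgtP h 0; last by exists 0; rewrite ?normr0// subrr mulr0.
  - have := @MVT _ W (fun x => u (x + e) - u x) h 0 h0.
    case.
    + by move=> x; rewrite in_itv/= => hx; apply: dW; lra.
    + apply: derivable_within_continuous => x; rewrite in_itv/= => hx.
      by have [] : is_derive x 1 W (u (x + e) - u x) by apply: dW; lra.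
    + move=> c; rewrite in_itv/= => /andP[hc c0] E; exists c.
        by rewrite (ltr0_norm h0) (ltr0_norm c0) lerN2 ltW.
      by rewrite -opprB E sub0r mulrN opprK.
  - have := @MVT _ W (fun x => u (x + e) - u x) 0 h h0.
    case.
    + by move=> x; rewrite in_itv/= => hx; apply: dW; lra.
    + apply: derivable_within_continuous => x; rewrite in_itv/= => hx.
      by have [] : is_derive x 1 W (u (x + e) - u x) by apply: dW; lra.
    + move=> c; rewrite in_itv/= => /andP[c0 hc] E; exists c.
        by rewrite (gtr0_norm h0) (gtr0_norm c0) ltW.
      by rewrite E subr0.
have -> : (U (h + e) - U h) / e - (U e - U 0) / e - h * ((u e - u 0) / e) =
   ((u (c + e) - u e) - (u c - u 0)) * (h / e).
  have W0 : W 0 = U e - U 0 by rewrite /W add0r.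
  by rewrite -mulrBl -[U (h + e) - U h]/(W h) -W0 E; field; rewrite gt_eqF.
rewrite normrM normrM normfV (gtr0_norm e0).
have B : `|u (c + e) - u e - (u c - u 0)| <= 2 * L * `|h|.
  apply: (le_trans (ler_normB _ _)).
  have := uL (c + e) e; have := uL c 0; rewrite subr0 addrK.
  have : L * `|c| <= L * `|h| by rewrite ler_wpM2l.
  by lra.
have -> : 2 * L / e * h ^+ 2 = 2 * L * `|h| * (`|h| / e).
  by rewrite -(real_normK (num_real h)); ring.
by rewrite ler_wpM2r// divr_ge0// ltW.
Qed.

End unit_mean.

(** * Averaging along a coordinate direction *)

Section steklov.
Context {R : realType} (n : nat).
Local Notation e_ j := (delta_mx 0 j : 'rV[R]_n).
Implicit Types (G H K : 'rV[R]_n -> R) (x y v : 'rV[R]_n).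

(** A Lipschitz condition along the coordinate directions is enough for the
derivatives of the averages, and implies a Lipschitz bound for the sup norm. *)
Definition coord_lipschitz M K :=
  forall x j (t : R), `|K (x + t *: e_ j) - K x| <= M * `|t|.

Lemma l2norm_delta j : l2norm (e_ j) = 1.
Proof.
rewrite /l2norm (bigD1 j)//= big1 ?addr0; first by rewrite mxE !eqxx expr1n sqrtr1.
by move=> i ij; rewrite mxE (negbTE ij) andbF expr0n.
Qed.

Lemma l2_coord_lipschitz L G : l2_lipschitz L G -> coord_lipschitz L G.
Proof.
move=> GL x j t; apply: (le_trans (GL _ _)).
by rewrite addrC addKr l2normZ l2norm_delta mulr1.
Qed.

Lemma normr_coord v j : `|v 0 j| <= `|v|.
Proof.
rewrite [leRHS]mx_normrE; apply: le_trans (le_bigmax _ _ (ord0, j)) => //=.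
Qed.

(** Walk from [x] along the coordinates of [s], one after the other. *)
Lemma coord_lipschitz_sum M K (s : seq 'I_n) x v : coord_lipschitz M K ->
  `|K (x + \sum_(j <- s) v 0 j *: e_ j) - K x| <= (size s)%:R * (M * `|v|).
Proof.
move=> KM; elim: s x => [|j s IH] x; first by rewrite big_nil addr0 subrr normr0 mul0r.
have M0 : 0 <= M by have := KM x j 1; rewrite normr1 mulr1; exact: le_trans.
rewrite big_cons addrA /= -[(size s).+1]addn1 natrD mulrDl mul1r.
rewrite -[X in `|X|](subrKA (K (x + v 0 j *: e_ j))); apply: (le_trans (ler_normD _ _)).
by rewrite lerD// (le_trans (KM _ _ _))// ler_wpM2l// normr_coord.
Qed.

Lemma row_sum_seq v : \sum_(j <- index_enum 'I_n) v 0 j *: e_ j = v.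
Proof. by rewrite [RHS]row_sum_delta. Qed.

Lemma coord_lipschitz_continuous M K : coord_lipschitz M K -> continuous K.
Proof.
move=> KM x; apply: (proj2 (@cvgrPdist_lt _ _ _ _ (nbhs_filter x) K (K x))) => eps eps0.
pose C := (size (index_enum 'I_n))%:R * `|M|.
have C1 : 0 < C + 1 by rewrite ltr_wpDl// mulr_ge0.
near=> y.
have := coord_lipschitz_sum (index_enum 'I_n) x (y - x) KM.
rewrite row_sum_seq [x + _]addrC subrK distrC => KB; apply: (le_lt_trans KB).
apply: (@le_lt_trans _ _ ((C + 1) * `|y - x|)).
  rewrite mulrDl mul1r ler_wpDr// -mulrA ler_wpM2l// ler_wpM2r//; exact: ler_norm.
rewrite mulrC -ltr_pdivlMr// distrC.
near: y; have := @cvgr_dist_lt _ _ _ _ (nbhs_filter x) id x cvg_id _ (divr_gt0 eps0 C1); exact.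
Unshelve. all: by end_near.
Qed.

(** The average of [K] over the segment from x to x + e e_i (a Steklov average). *)
Definition steklov i (e : R) K x := unit_mean (fun s => K (x + (e * s) *: e_ i)).

Lemma continuous_line K x v e : continuous K -> continuous (fun s : R => K (x + (e * s) *: v)).
Proof.
move=> cK s; apply: (continuous_cvg _ (@cK _)); apply: cvgD; first exact: cvg_cst.
by apply: cvgZr_tmp; apply: cvgMl_tmp.
Qed.

Lemma steklov_dist B K x y i e : continuous K ->
  (forall t : R, `|K (x + t *: e_ i) - K (y + t *: e_ i)| <= B) ->
  `|steklov i e K x - steklov i e K y| <= B.
Proof.
move=> cK KB; rewrite -unit_meanB; try exact: continuous_line.
apply: unit_mean_bound => [s|s _]; last exact: KB.
by apply: cvgB; exact: continuous_line.
Qed.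

Lemma steklov_l2_lipschitz L G i e : l2_lipschitz L G -> l2_lipschitz L (steklov i e G).
Proof.
move=> GL x y; apply: steklov_dist => [|t].
  exact: (coord_lipschitz_continuous (l2_coord_lipschitz GL)).
by apply: (le_trans (GL _ _)); rewrite opprD addrACA subrr addr0.
Qed.

Lemma steklov_coord_lipschitz M K i e :
  coord_lipschitz M K -> coord_lipschitz M (steklov i e K).
Proof.
move=> KM x j t; apply: steklov_dist => [|s].
  exact: (coord_lipschitz_continuous KM).
by rewrite addrAC; exact: KM.
Qed.

Lemma steklov_close M K i e x : 0 <= e -> coord_lipschitz M K ->
  `|steklov i e K x - K x| <= M * e.
Proof.
move=> e0 KM; have cK := coord_lipschitz_continuous KM.
have M0 : 0 <= M by have := KM x i 1; rewrite normr1 mulr1; exact: le_trans.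
rewrite -[K x in X in X <= _]unit_mean_cst -unit_meanB; last 2 first.
- exact: continuous_line.
- exact: cst_continuous.
apply: unit_mean_bound => [s|s /andP[s0 s1]].
  by apply: cvgB; [exact: continuous_line|exact: cvg_cst].
apply: (le_trans (KM _ _ _)); rewrite ler_wpM2l// ger0_norm ?mulr_ge0//.
by rewrite ler_piMr.
Qed.

(** A derivative in direction j in a quantitative form, which unlike a limit passes
through averages without interchanging limit and integral. *)
Definition expands_along H j K :=
  exists C, forall x (h : R), `|H (x + h *: e_ j) - H x - h * K x| <= C * h ^+ 2.

Definition regular_along H j :=
  exists K, [/\ (exists M, coord_lipschitz M K) & expands_along H j K].

(** Averaging in direction j creates a derivative in this direction, the difference
quotient of G over the length of the segment. *)
Lemma steklov_regular_same L G j e : 0 < e -> coord_lipschitz L G ->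
  regular_along (steklov j e G) j.
Proof.
move=> e0 GL; exists (fun x => (G (x + e *: e_ j) - G x) / e); split.
  exists (2 * L / e) => x i t.
  have -> : (G (x + t *: e_ i + e *: e_ j) - G (x + t *: e_ i)) / e - (G (x + e *: e_ j) - G x) / e
    = ((G (x + e *: e_ j + t *: e_ i) - G (x + e *: e_ j)) - (G (x + t *: e_ i) - G x)) / e.
    by rewrite -mulrBl [x + t *: _ + _]addrAC; congr (_ / e); ring.
  rewrite normrM normfV (gtr0_norm e0) mulrAC ler_pM2r ?invr_gt0//.
  apply: (le_trans (ler_normB _ _)).
  by have := GL x i t; have := GL (x + e *: e_ j) i t; lra.
exists (2 * L / e) => x h.
pose u t := G (x + t *: e_ j).
have cu : continuous u.
  have -> : u = (fun s => G (x + (1 * s) *: e_ j)) by apply/funext => s; rewrite mul1r.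
  exact: continuous_line (coord_lipschitz_continuous GL).
have uL (a b : R) : `|u a - u b| <= L * `|a - b|.
  have := GL (x + b *: e_ j) j (a - b).
  by rewrite -addrA -scalerDl [b + _]addrC subrK.
have E : steklov j e G (x + h *: e_ j) = unit_mean (fun s => u (h + e * s)).
  by congr unit_mean; apply/funext => s; rewrite /u scalerDl addrA.
have u0 : u 0 = G x by rewrite /u scale0r addr0.
rewrite E -u0; exact: (unit_mean_shift h e0 cu uL).
Qed.

(** Averaging in another direction keeps the regularity already gained: the
expansion of H is averaged term by term. *)
Lemma steklov_regular H i j e M : coord_lipschitz M H ->
  regular_along H j -> regular_along (steklov i e H) j.
Proof.
move=> HM [K [[M' KM'] [C HC]]]; exists (steklov i e K); split.
  by exists M'; exact: steklov_coord_lipschitz.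
have cH := coord_lipschitz_continuous HM.
have cK := coord_lipschitz_continuous KM'.
exists C => x h.
have c1 y : continuous (fun s : R => H (y + (e * s) *: e_ i)) by exact: continuous_line.
have c2 : continuous (fun s : R => h * K (x + (e * s) *: e_ i)).
  by move=> s; apply: cvgMl_tmp; exact: continuous_line.
have c3 : continuous (fun s : R => H (x + h *: e_ j + (e * s) *: e_ i) - H (x + (e * s) *: e_ i)).
  by move=> s; apply: cvgB; exact: c1.
rewrite /steklov -unit_meanZ//; last exact: continuous_line.
rewrite -unit_meanB// -unit_meanB//.
apply: unit_mean_bound => [s|s _]; first by apply: cvgB; [exact: c3|exact: c2].
by rewrite [x + h *: _ + _]addrAC; exact: HC.
Qed.

End steklov.

(** * Smooth approximation of Lipschitz functions *)

Section smoothing.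
Context {R : realType} (n : nat).
Local Notation e_ j := (delta_mx 0 j : 'rV[R]_n).
Implicit Types (G H : 'rV[R]_n -> R) (x y v : 'rV[R]_n).

(** Add the increments v_j e_j one at a time: each is expanded at the current point,
and moving its derivative back to x costs a term of order |v| ^ 2 because the
derivatives are Lipschitz. *)
Lemma expansion_sum H (K : 'I_n -> 'rV[R]_n -> R) (s : seq 'I_n) :
  (forall j, exists M, coord_lipschitz M (K j)) ->
  (forall j, expands_along H j (K j)) ->
  exists2 C, 0 <= C & forall x v,
    `|H (x + \sum_(j <- s) v 0 j *: e_ j) - H x - \sum_(j <- s) v 0 j * K j x| <=
    C * `|v| ^+ 2.
Proof.
move=> KM HK; elim: s => [|j s [C C0 IH]].
  exists 0 => // x v; rewrite !big_nil addr0 subrr subr0 normr0.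
  by rewrite mulr_ge0// sqr_ge0.
have [M KMj] := KM j; have [D HD] := HK j.
have M0 : 0 <= M by have := KMj 0 j 1; rewrite normr1 mulr1; exact: le_trans.
exists (C + `|D| + (size s)%:R * M) => [|x v].
  by rewrite !addr_ge0// mulr_ge0.
rewrite !big_cons; set S := \sum_(_ <- _) _ *: _; set T := \sum_(_ <- _) _ * _.
have -> : H (x + (v 0 j *: e_ j + S)) - H x - (v 0 j * K j x + T) =
  (H (x + S + v 0 j *: e_ j) - H (x + S) - v 0 j * K j (x + S)) +
  (H (x + S) - H x - T) + v 0 j * (K j (x + S) - K j x).
  by rewrite [v 0 j *: _ + S]addrC addrA; ring.
have vj := normr_coord v j.
have v2 : v 0 j ^+ 2 <= `|v| ^+ 2.
  by rewrite -(real_normK (num_real (v 0 j))) lerXn2r ?nnegrE.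
apply: (le_trans (ler_normD _ _)); rewrite mulrDl; apply: lerD; last first.
  rewrite normrM -mulrA expr2 mulrA [_ * (_ * _)]mulrCA.
  rewrite [leRHS](_ : _ = `|v| * ((size s)%:R * (M * `|v|))); last by ring.
  by apply: ler_pM => //; exact: coord_lipschitz_sum.
apply: (le_trans (ler_normD _ _)); rewrite addrC mulrDl lerD//; first exact: IH.
apply: (le_trans (HD _ _)); apply: (@le_trans _ _ (`|D| * v 0 j ^+ 2)).
  by rewrite ler_wpM2r ?sqr_ge0// ler_norm.
by rewrite ler_wpM2l.
Qed.

(** The first order expansions in the coordinate directions add up to a total
expansion with quadratic remainder. *)
Lemma regular_differentiable H : (forall j, regular_along H j) ->
  (forall x, differentiable H x) /\ continuous (grad H).
Proof.
move=> /choice[K HK].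
have KM j : exists M, coord_lipschitz M (K j) by have [] := HK j.
have KE j : expands_along H j (K j) by have [] := HK j.
have [C C0 HC] := expansion_sum (index_enum 'I_n) KM KE.
pose g x : 'rV[R]_n := \row_j K j x.
pose df x : 'rV[R]_n -> R := fun v => dot v (g x).
have dflin x : linear (df x).
  by move=> a u v; rewrite /df dotC -[v]scale1r dot_lincomb !(dotC (g x)) mul1r scale1r.
pose dfM x := GRing.isLinear.Build _ _ _ _ _ (dflin x).
pose dfL x : {linear 'rV[R]_n -> R} := HB.pack (df x) (dfM x).
have cdf x : continuous (dfL x).
  have -> : (dfL x : 'rV[R]_n -> R) = dot (g x) by apply/funext => v; exact: dotC.
  exact: continuous_dot.
have exp x : H \o shift x = cst (H x) + dfL x +o_ (0 : 'rV[R]_n) id.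
  apply/eqaddoP => eps eps0; near=> v.
  have -> : (H \o shift x - (cst (H x) + dfL x)) v =
      H (x + v) - H x - \sum_(j <- index_enum 'I_n) v 0 j * K j x.
    rewrite -[LHS]/(H (v + x) - (H x + df x v)) opprD addrA [v + x]addrC.
    by congr (_ - _); apply: eq_bigr => j _; rewrite mxE.
  have := HC x v; rewrite row_sum_seq => /le_trans; apply.
  rewrite expr2 mulrA ler_wpM2r//; apply: (@le_trans _ _ ((C + 1) * `|v|)).
    by rewrite mulrDl lerDl mul1r.
  rewrite mulrC -ler_pdivlMr ?ltr_wpDl//.
  near: v.
  have eC : 0 < eps / (C + 1) by rewrite divr_gt0// ltr_wpDl.
  have := @nbhs0_le R 'rV[R]_n _ eC; exact.
have dE x := diff_unique (cdf x) (exp x).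
have dH x : differentiable H x.
  by apply/diff_locallyP; rewrite dE; split; [exact: cdf|exact: exp].
split=> // x.
have -> : grad H = g.
  apply/funext => y; apply/rowP => j.
  by rewrite !mxE deriveE// dE /= /df dotC dot_delta mxE.
suff near_ball eps : 0 < eps -> \forall y \near x, ball (g x) eps (g y).
  by have := proj2 (@cvg_ballP R _ _ _ (nbhs_filter x) g (g x)) near_ball; exact.
move=> eps0.
have near_coord j : \forall y \near x, `|g x 0 j - g y 0 j| < eps.
  have [M KMj] := KM j.
  have cK := coord_lipschitz_continuous KMj; have := @cK x.
  move=> /(proj1 (@cvgrPdist_lt _ _ _ _ (nbhs_filter x) _ _)) /(_ _ eps0).
  by apply: filterS => y; rewrite !mxE.
have := filter_forall (nbhs_filter x) near_coord; apply: filterS => y gy.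
exact/rV_ballP.
Unshelve. all: by end_near.
Qed.

(** Average once along every coordinate direction over segments of length e. Each
average preserves the Lipschitz constant and moves the function by at most
L e. *)
Lemma smooth_approximation L G (delta : R) : 0 < delta -> l2_lipschitz L G ->
  exists H, [/\ forall x, differentiable H x, continuous (grad H),
    l2_lipschitz L H & forall x, `|H x - G x| <= delta].
Proof.
move=> d0 GL.
have main (e : R) (s : seq 'I_n) : 0 < e -> exists H, [/\ l2_lipschitz L H,
    forall x, `|H x - G x| <= (size s)%:R * (L * e) &
    forall j, j \in s -> regular_along H j].
  move=> e0; elim: s => [|i s [H [HL HG Hr]]].
    by exists G; split => // x; rewrite subrr normr0 mul0r.
  have Hc := l2_coord_lipschitz HL.
  exists (steklov i e H); split; first exact: steklov_l2_lipschitz.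
    move=> x; rewrite -[X in `|X|](subrKA (H x)); apply: (le_trans (ler_normD _ _)).
    rewrite /= -[(size s).+1]addn1 natrD mulrDl mul1r addrC lerD//.
    by apply: steklov_close => //; exact: ltW.
  move=> j; rewrite inE => /predU1P[->|js]; first exact: steklov_regular_same.
  exact: steklov_regular (Hr j js).
pose C := (size (index_enum 'I_n))%:R * `|L|.
have C1 : 0 < C + 1 by rewrite ltr_wpDl// mulr_ge0.
have e0 : 0 < delta / (C + 1) by exact: divr_gt0.
have [H [HL HG Hr]] := main _ (index_enum 'I_n) e0.
have [dH cH] : (forall x, differentiable H x) /\ continuous (grad H).
  by apply: regular_differentiable => j; apply: Hr; rewrite mem_index_enum.
exists H; split => // x; apply: (le_trans (HG x)).
apply: (@le_trans _ _ (C * (delta / (C + 1)))).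
  by rewrite mulrA ler_wpM2r ?(ltW e0)// ler_wpM2l// ler_norm.
by rewrite mulrCA ger_pMr// ler_pdivrMr// mul1r lerDl.
Qed.

End smoothing.

(** * The two variance bounds *)

Section final.
Context {R : realType}.
Local Notation lap n := (mpow (@laplace_prob R) n).

Lemma dot_l1proj_le1 n (x : borel_rV R n) : dot (l1proj x : 'rV[R]_n) (l1proj x) <= 1.
Proof.
apply: (@le_trans _ _ (\sum_(i < n) `|(l1proj x : 'rV[R]_n) 0 i|)).
  by apply: ler_sum => i _; rewrite -expr2 -real_normK ?num_real// expr2 ler_piMl// l1proj_coord.
have [r0|r0] := eqVneq (l1norm (x : 'rV[R]_n)) 0.
  by rewrite big1// => i _; rewrite mxE r0 invr0 mul0r normr0.
under eq_bigr do rewrite mxE normrM ger0_norm ?invr_ge0 ?l1norm_ge0//.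
by rewrite -mulr_sumr mulVf.
Qed.

(** Under the hypotheses t <= n, so t ^ 2 <= n t <= n (1 + 2 t); add n t ^ 2. *)
Lemma weight_comparison n (t : R) : (2 <= n)%N -> 0 <= t -> t ^+ 2 <= n%:R ^+ 2 ->
  t ^+ 2 / n%:R <= (1 + t) ^+ 2 / n.+1%:R.
Proof.
move=> n2 t0 tn; have n0 : 0 < n%:R :> R by rewrite ltr0n; exact: leq_trans n2.
have {}tn : t <= n%:R by rewrite -(@ler_pXn2r _ 2)// nnegrE ltW.
rewrite ler_pdivrMr// mulrAC ler_pdivlMr ?ltr0n// -natr1.
have : t * t <= n%:R * t by rewrite ler_wpM2r.
have : 0 <= n%:R * t by rewrite mulr_ge0// ltW.
rewrite !expr2; set m : R := n%:R in n0 tn *; lra.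
Qed.

Lemma natr_succ_le_sq n : (2 <= n)%N -> n.+1%:R <= n%:R ^+ 2 :> R.
Proof.
move=> n2; rewrite -natrX ler_nat -mulnn (leq_trans _ (leq_mul n2 (leqnn n)))//.
by rewrite mul2n -addnn -addn1 leq_add2l ltnW.
Qed.

Section law.
Context {dO : measure_display} {Omega : measurableType dO} (P : probability Omega R).
Variables (n : nat) (n2 : (2 <= n)%N).
Variables (zeta : {RV P >-> borel_rV R n.+1}) (hzeta : uniform_on_l1sphere zeta).

Theorem variance_continuously_differentiable (G : 'rV[R]_n.+1 -> R) :
  continuously_differentiable G ->
  ('V_P[fun w => G (zeta w)] <= (4 / (n.+1%:R * (n.+1%:R - 2)))%:E *
   'E_P[fun w => (l2norm (grad G (zeta w)) ^+ 2 *
      (1 + Num.sqrt n.+1%:R * l2norm (zeta w : 'rV[R]_n.+1)) ^+ 2)%R])%E.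
Proof.
move=> [dG cG].
have mid : measurable_fun setT (fun z : borel_rV R n.+1 => z) by exact: measurable_id.
have mgrad : measurable_fun setT (fun z : borel_rV R n.+1 => grad G z : borel_rV R n.+1).
  by apply: measurable_fun_rV => i; exact: measurable_gradG.
pose psi (z : borel_rV R n.+1) : R := l2norm (grad G z) ^+ 2 *
  (1 + Num.sqrt n.+1%:R * l2norm (z : 'rV[R]_n.+1)) ^+ 2.
pose phi (z : borel_rV R n.+1) : R := n.+1%:R * dot (z : 'rV[R]_n.+1) z *
  dot (grad G z) (grad G z).
have mphi : measurable_fun setT (EFin \o phi).
  apply/measurable_EFinP; apply: measurable_funM; last exact: measurable_dot.
  by apply: measurable_funM => //; exact: measurable_dot.
have ml2 : measurable_fun setT (fun z : borel_rV R n.+1 => l2norm (z : 'rV[R]_n.+1)).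
  have -> : (fun z : borel_rV R n.+1 => l2norm (z : 'rV[R]_n.+1)) =
     (fun z : borel_rV R n.+1 => Num.sqrt (dot (z : 'rV[R]_n.+1) z)).
    by apply/funext => z; rewrite -l2norm_sq sqrtr_sqr ger0_norm// sqrtr_ge0.
  apply: measurableT_comp (measurable_dot mid mid).
  exact: continuous_measurable_fun (@sqrt_continuous R).
have mpsi : measurable_fun setT (EFin \o psi).
  apply/measurable_EFinP; apply: measurable_funM.
    by under eq_fun do rewrite l2norm_sq; exact: measurable_dot.
  by apply: measurable_funX; apply: measurable_funD => //; exact: measurable_funM.
have phi0 z : (0 <= (EFin \o phi) z)%E by rewrite lee_fin !mulr_ge0// dot_ge0.
have psi0 z : (0 <= (EFin \o psi) z)%E by rewrite lee_fin mulr_ge0// sqr_ge0.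
have n0 : 0 < n%:R :> R by rewrite ltr0n; exact: leq_trans n2.
have n10 : 0 < n%:R - 1 :> R by rewrite subr_gt0 ltr1n.
have N0 : 0 < n.+1%:R :> R by rewrite ltr0n.
have N2 : n.+1%:R - 2 = n%:R - 1 :> R by rewrite -natr1; lra.
rewrite (variance_uniform hzeta (measurable_G dG)).
apply: (le_trans (variance_C1 n2 dG cG)).
rewrite expectation.unlock.
have -> : (\int[P]_w (psi (zeta w))%:E = \int[lap n.+1]_x (psi (l1proj x))%:E)%E.
  exact: (ge0_integral_uniform hzeta mpsi psi0).
have mN := @measurable_l1proj R n.+1.
rewrite -ge0_integralZl//; last first.
- by rewrite lee_fin divr_ge0// mulr_ge0// ltW.
- by move=> x _; exact: (phi0 (l1proj x)).
- exact: (measurableT_comp mphi mN).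
rewrite -ge0_integralZl//; last first.
- by rewrite lee_fin divr_ge0// mulr_ge0 ?ltW// N2.
- by move=> x _; exact: (psi0 (l1proj x)).
- exact: (measurableT_comp mpsi mN).
apply: ge0_le_integral => //.
- move=> x _; apply: mule_ge0; last exact: (phi0 (l1proj x)).
  by rewrite lee_fin divr_ge0// mulr_ge0// ltW.
- by apply: emeasurable_funM => //; exact: (measurableT_comp mphi mN).
- by apply: emeasurable_funM => //; exact: (measurableT_comp mpsi mN).
move=> x _; rewrite -!EFinM lee_fin; set z : 'rV[R]_n.+1 := l1proj x.
pose t := Num.sqrt n.+1%:R * l2norm z.
have t2 : t ^+ 2 = n.+1%:R * dot z z by rewrite exprMn sqr_sqrtr ?ltW// l2norm_sq.
have t0 : 0 <= t by rewrite mulr_ge0 ?sqrtr_ge0.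
have : t ^+ 2 / n%:R <= (1 + t) ^+ 2 / n.+1%:R.
  apply: weight_comparison => //; rewrite t2.
  rewrite (le_trans _ (natr_succ_le_sq n2))// ler_piMr ?(ltW N0)//; exact: dot_l1proj_le1.
rewrite N2 /psi l2norm_sq -/z -/t -t2; set q := dot (grad G z) _.
have q0 : 0 <= q by exact: dot_ge0.
move=> h; have k0 : 0 <= 4 / (n%:R - 1) * q by rewrite mulr_ge0// divr_ge0// ltW.
have := ler_wpM2l k0 h; move: (gt_eqF n0) (gt_eqF n10) (gt_eqF N0).
move: (n%:R - 1 : R) (n%:R : R) (n.+1%:R : R) => a b c b0 a0 c0; congr (_ <= _).
  by field; rewrite a0 b0.
by field; rewrite a0 c0.
Qed.

End law.

Lemma variance_lipschitz_C1 n (L : R) (G : 'rV[R]_n.+1 -> R) : (2 <= n)%N ->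
  (forall x, differentiable G x) -> continuous (grad G) -> l2_lipschitz L G ->
  (variance_of (lap n.+1) (G \o @l1proj R n.+1) <=
   (4 * L ^+ 2 / (n%:R * (n%:R - 1)) * (2 * n.+1%:R / (n.+1%:R + 1)))%:E)%E.
Proof.
move=> n2 dG cG GL; apply: (le_trans (variance_C1 n2 dG cG)).
have n0 : 0 < n%:R :> R by rewrite ltr0n; exact: leq_trans n2.
have n10 : 0 < n%:R - 1 :> R by rewrite subr_gt0 ltr1n.
have mid : measurable_fun setT (fun z : borel_rV R n.+1 => z) by exact: measurable_id.
have mgrad : measurable_fun setT (fun z : borel_rV R n.+1 => grad G z : borel_rV R n.+1).
  by apply: measurable_fun_rV => i; exact: measurable_gradG.
have mN := @measurable_l1proj R n.+1.
have mz := measurable_dot mN mN.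
have mg := measurable_dot (measurableT_comp mgrad mN) (measurableT_comp mgrad mN).
have -> : 4 * L ^+ 2 / (n%:R * (n%:R - 1)) * (2 * n.+1%:R / (n.+1%:R + 1)) =
  4 / (n%:R * (n%:R - 1)) * (n.+1%:R * L ^+ 2 * (2 / (n.+1%:R + 1))) by ring.
rewrite [leRHS]EFinM lee_wpmul2l//; first by rewrite lee_fin divr_ge0// mulr_ge0// ltW.
rewrite [leRHS]EFinM -l1proj_second_moment -ge0_integralZl//; last first.
- by rewrite lee_fin mulr_ge0// sqr_ge0.
- by move=> x _; rewrite lee_fin dot_ge0.
- exact/measurable_EFinP.
apply: ge0_le_integral => //.
- by move=> x _; rewrite lee_fin !mulr_ge0// dot_ge0.
- apply/measurable_EFinP; apply: measurable_funM => //; exact: measurable_funM.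
- by apply: emeasurable_funM => //; exact/measurable_EFinP.
move=> x _; rewrite -EFinM lee_fin mulrAC ler_wpM2r ?dot_ge0// ler_wpM2l//.
exact: grad_lipschitz.
Qed.

Local Open Scope ereal_scope.
(** Let c be the mean of h. The variance of f is at most the mean of (f - c) ^ 2,
and (a + b) ^ 2 <= (1 + delta) a ^ 2 + (1 + 1 / delta) b ^ 2 applies with
a = h - c and |b| = |f - h| <= delta. *)
Lemma variance_of_perturb d (T : measurableType d) (mu : {measure set T -> \bar R})
    (f h : T -> R) (B V delta : R) :
  mu setT = 1 -> measurable_fun setT f -> measurable_fun setT h ->
  (forall x, (`|h x| <= B)%R) -> (0 < delta)%R -> (forall x, (`|h x - f x| <= delta)%R) ->
  variance_of mu h <= V%:E ->
  variance_of mu f <= ((1 + delta) * V + (1 + delta) * delta)%:E.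
Proof.
move=> mu1 mf mh hB d0 hf hV.
have fB x : (`|f x| <= B + delta)%R.
  rewrite -[f x](subKr (h x)) (le_trans (ler_normB _ _))// lerD// hf.
set c := fine (\int[mu]_y (h y)%:E).
apply: (le_trans (variance_of_le c mu1 mf fB)).
have mh2 : measurable_fun setT (fun x => ((h x - c) ^+ 2)%R%:E : \bar R).
  by apply/measurable_EFinP; apply: measurable_funX; exact: measurable_funB.
have mf2 : measurable_fun setT (fun x => ((f x - c) ^+ 2)%R%:E : \bar R).
  by apply/measurable_EFinP; apply: measurable_funX; exact: measurable_funB.
have h0 x : 0 <= ((h x - c) ^+ 2)%R%:E by rewrite lee_fin sqr_ge0.
have k0 : 0 <= (1 + delta)%R%:E by rewrite lee_fin addr_ge0// ltW.
have kd0 : 0 <= ((1 + delta) * delta)%R%:E.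
  by rewrite lee_fin mulr_ge0// ?addr_ge0// ltW.
apply: (@le_trans _ _ (\int[mu]_x
    ((1 + delta)%R%:E * ((h x - c) ^+ 2)%R%:E + ((1 + delta) * delta)%R%:E))).
  apply: ge0_le_integral => //.
  - by move=> x _; rewrite lee_fin sqr_ge0.
  - by apply: emeasurable_funD => //; exact: emeasurable_funM.
  move=> x _; rewrite -EFinM -EFinD lee_fin.
  have -> : (f x - c = (h x - c) - (h x - f x))%R by ring.
  set a : R := (h x - c)%R; set b : R := (h x - f x)%R.
  have b2 : (b ^+ 2 <= delta ^+ 2)%R.
    rewrite -(real_normK (num_real b)) lerXn2r ?nnegrE//; first exact: ltW.
    exact: hf.
  (* after multiplication by delta the gap contains the square of
     delta a + b *)
  rewrite -(ler_pM2l d0).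
  have := sqr_ge0 (delta * a + b)%R.
  have : ((1 + delta) * b ^+ 2 <= (1 + delta) * delta ^+ 2)%R.
    by rewrite ler_wpM2l// addr_ge0// ltW.
  rewrite !expr2; lra.
rewrite ge0_integralD//; last 2 first.
- by move=> x _; exact: mule_ge0.
- exact: emeasurable_funM.
rewrite ge0_integralZl// integral_cst// [leRHS]EFinD [X in _ <= X + _]EFinM leeD//.
  by rewrite lee_wpmul2l.
by rewrite [X in _ * X]mu1 mule1.
Qed.

Local Close Scope ereal_scope.

Lemma variance_lipschitz n (L : R) (G : 'rV[R]_n.+1 -> R) : (2 <= n)%N ->
  l2_lipschitz L G ->
  measurable_fun setT (G : borel_rV R n.+1 -> R) /\
  (variance_of (lap n.+1) (G \o @l1proj R n.+1) <=
   (4 * L ^+ 2 / (n%:R * (n%:R - 1)) * (2 * n.+1%:R / (n.+1%:R + 1)))%:E)%E.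
Proof.
move=> n2 GL.
have mG : measurable_fun setT (G : borel_rV R n.+1 -> R).
  apply: continuous_measurable_rV.
  exact: (coord_lipschitz_continuous (l2_coord_lipschitz GL)).
split=> //; set V : R := (_ * _)%R.
have n10 : 0 < n%:R - 1 :> R by rewrite subr_gt0 ltr1n.
have V0 : 0 <= V.
  have nn0 : 0 <= n%:R * (n%:R - 1) :> R by rewrite mulr_ge0// ltW.
  apply: mulr_ge0; first by rewrite divr_ge0// mulr_ge0// sqr_ge0.
  by rewrite divr_ge0// addr_ge0.
apply/lee_addgt0Pr => eps eps0.
(* for delta <= 1 the perturbed bound exceeds V by at most delta (V + 2) *)
pose delta := Num.min 1 (eps / (V + 2)).
have V2 : 0 < V + 2 by lra.
have d0 : 0 < delta by rewrite lt_min ltr01 divr_gt0.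
have [H [dH cH HL HG]] := smooth_approximation d0 GL.
have [B HB] := bounded_G_l1proj dH.
have mN := @measurable_l1proj R n.+1.
have h1 : (lap n.+1 setT = 1)%E by exact: mpow1.
have := @variance_of_perturb _ _ (lap n.+1) (G \o @l1proj R n.+1) (H \o @l1proj R n.+1)
  B V delta h1 (measurableT_comp mG mN) (measurableT_comp (measurable_G dH) mN)
  HB d0 (fun x => HG _) (variance_lipschitz_C1 n2 dH cH HL).
move=> /le_trans; apply; rewrite -EFinD lee_fin.
have d1 : delta <= 1 by rewrite ge_min lexx.
have dV : delta * (V + 2) <= eps.
  by rewrite -ler_pdivlMr// ge_min lexx orbT.
have : delta * delta <= delta * 1 by rewrite ler_wpM2l// ltW.
lra.
Qed.

End final.

Theorem lemma3 (R : realType) (dO : measure_display) (Omega : measurableType dO)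
    (P : probability Omega R) (d : nat) (hd : (3 <= d)%N)
    (zeta : {RV P >-> borel_rV R d}) (hzeta : uniform_on_l1sphere zeta) :
  (forall G : 'rV[R]_d -> R, continuously_differentiable G ->
    ('V_P[fun w => G (zeta w)] <=
     (4 / (d%:R * (d%:R - 2)))%:E *
     'E_P[fun w => (l2norm (grad G (zeta w)) ^+ 2 *
                    (1 + Num.sqrt d%:R * l2norm (zeta w : 'rV[R]_d)) ^+ 2)%R])%E)
  /\
  (forall (L : R) (G : 'rV[R]_d -> R), l2_lipschitz L G ->
    ('V_P[fun w => G (zeta w)] <=
     (4 * L ^+ 2 / (d%:R * (d%:R - 2)) *
      (1 + Num.sqrt (2 * d%:R / (d%:R + 1))) ^+ 2)%:E)%E).
Proof.
case: d hd zeta hzeta => [//|n] hn zeta hzeta.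
have n2 : (2 <= n)%N by [].
split=> [G|L G GL]; first exact: variance_continuously_differentiable.
have [mG] := variance_lipschitz n2 GL.
rewrite (variance_uniform hzeta mG) => /le_trans; apply; rewrite lee_fin.
have n0 : 0 < n%:R :> R by rewrite ltr0n; exact: leq_trans n2.
have n10 : 0 < n%:R - 1 :> R by rewrite subr_gt0 ltr1n.
have N0 : 0 < n.+1%:R :> R by rewrite ltr0n.
have N10 : 0 < n.+1%:R + 1 :> R by rewrite addr_gt0.
have N2 : n.+1%:R - 2 = n%:R - 1 :> R by rewrite -natr1; lra.
set s := Num.sqrt _.
have s2 : s ^+ 2 = 2 * n.+1%:R / (n.+1%:R + 1).
  by rewrite sqr_sqrtr// divr_ge0 ?mulr_ge0 ?ltW.
have : s ^+ 2 / n%:R <= (1 + s) ^+ 2 / n.+1%:R.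
  apply: weight_comparison; rewrite ?sqrtr_ge0//.
  apply: (@le_trans _ _ 2).
    by rewrite s2 ler_pdivrMr// ler_wpM2l// lerDl.
  by rewrite -natrX ler_nat (leq_trans n2)// -mulnn leq_pmulr// (leq_trans _ n2).
rewrite -s2 N2 => h.
have k0 : 0 <= 4 * L ^+ 2 / (n%:R - 1) by apply: divr_ge0 (ltW n10); rewrite mulr_ge0// sqr_ge0.
have := ler_wpM2l k0 h; move: (gt_eqF n0) (gt_eqF n10) (gt_eqF N0).
move: (n%:R - 1 : R) (n%:R : R) (n.+1%:R : R) => a b c b0 a0 c0; congr (_ <= _).
  by field; rewrite a0 b0.
by field; rewrite a0 c0.
Qed.
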